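(* Let $d=1$, and let $\mathcal S$, $d_2$, $\mathcal G_S$, $\mathcal G_T$ be as defined in the context, for a bounded open interval $\Omega\subset\mathbb R$, an open interval $\Omega'\supset\overline\Omega$, and the alphabet $\mathcal I$. The sets $\mathcal G_S$ and $\mathcal G_T$ are dense in $(\mathcal S,d_2)$.
   Context: Fix $\mathcal I=\{1,\dots,N\}$ with $N\ge2$, a bounded open interval $\Omega\subset\mathbb R$ and an open interval $\Omega'\subset\mathbb R$ (possibly unbounded) with $\overline\Omega\subset\Omega'$. $\mathcal S$ is the set of tuples $\Phi=(\varphi_i)_{i\in\mathcal I}$ of real-analytic maps $\varphi_i:\Omega'\to\mathbb R$ with nowhere vanishing derivative such that $\varphi_i(\overline\Omega)\subset\Omega$ and $|\varphi_i'|<1$ on $\overline\Omega$ (conformal iterated function systems on $\Omega$ with extension domain $\Omega'$). With $\|h\|=\sup_{x\in\overline\Omega}|h(x)|$, $d_2(\Phi,\Psi)=\max_i(\|\varphi_i-\psi_i\|+\|\varphi_i'-\psi_i'\|+\|\varphi_i''-\psi_i''\|)$. Words: $\mathcal I^*$ finite words, $\mathcal I^{\mathbb N}$ infinite words, $|\mathtt i|$ the length (possibly $\infty$), $\mathtt i|_n$ the length-$n$ prefix. For $\mathtt i=i_1\cdots i_n$ put $f_{\mathtt i}=\varphi_{i_n}\circ\cdots\circ\varphi_{i_1}$, $T_{\mathtt i}=f_{\mathtt i}''/f_{\mathtt i}'$, $S_{\mathtt i}=(f_{\mathtt i}''/f_{\mathtt i}')'-\frac12(f_{\mathtt i}''/f_{\mathtt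 i}')^2$; for infinite $\mathtt i$, $T_{\mathtt i}$ and $S_{\mathtt i}$ are the uniform limits on $\overline\Omega$ of the prefix projections $T_{\mathtt i|_n}$, $S_{\mathtt i|_n}$ (which exist). Let $Z=\{(\mathtt i,\mathtt j)\in(\mathcal I^{\mathbb N}\cup\mathcal I^* )^2:|\mathtt i|=|\mathtt j|\ge1,\ i_1\ne j_1\}$, $\mathcal G_T=\{\Phi\in\mathcal S:\inf_{(\mathtt i,\mathtt j)\in Z}\|T_{\mathtt i}-T_{\mathtt j}\|>0\}$, $\mathcal G_S=\{\Phi\in\mathcal S:\inf_{(\mathtt i,\mathtt j)\in Z}\|S_{\mathtt i}-S_{\mathtt j}\|>0\}$. *)

(* Defs.v *)
From HB Require Import structures.
From mathcomp Require Import all_boot all_order all_algebra.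
From mathcomp Require Import all_classical all_reals all_analysis.

Set Implicit Arguments.
Unset Strict Implicit.
Unset Printing Implicit Defensive.

Import Order.TTheory GRing.Theory Num.Theory.
Import numFieldNormedType.Exports.

Local Open Scope classical_set_scope.
Local Open Scope ring_scope.

Section CIFS.
Variable R : realType.

(* Maps with an open domain D are represented by total functions R -> R.  As D
   is open, the radius r can be chosen so that the ball stays inside D: the
   values of f outside D are irrelevant. *)
Definition real_analytic (D : set R) (f : R -> R) : Prop :=
  forall x0, D x0 -> exists (a : R^nat) (r : R), 0 < r /\
    forall x, `|x - x0| < r -> pseries a (x - x0) @ \oo --> f x.

(* Used only for functions that are bounded on A, A nonempty; the real-valued
   [sup] is then the least upper bound. *)
Definition supnorm (A : set R) (h : R -> R) : R := sup [set `|h x| | x in A].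

Definition IFS (N : nat) := 'I_N -> R -> R.

Definition cifs (Omega Omega' : set R) (N : nat) : set (IFS N) :=
  [set Phi : IFS N | forall i, [/\ real_analytic Omega' (Phi i),
     forall x, Omega' x -> derive1 (Phi i) x != 0,
     Phi i @` closure Omega `<=` Omega &
     forall x, closure Omega x -> `|derive1 (Phi i) x| < 1]].

Definition d2 (Omega : set R) (N : nat) (Phi Psi : IFS N) : R :=
  \big[Num.max/0]_(i < N)
    (supnorm (closure Omega) (Phi i \- Psi i)
     + supnorm (closure Omega) (derive1 (Phi i) \- derive1 (Psi i))
     + supnorm (closure Omega) (derive1n 2 (Phi i) \- derive1n 2 (Psi i))).

Definition d2_dense (Omega : set R) (N : nat) (X G : set (IFS N)) : Prop :=
  G `<=` X /\
  forall Phi, X Phi -> forall e : R, 0 < e ->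
    exists2 Psi, G Psi & d2 Omega Phi Psi < e.

Inductive word (N : nat) : Type :=
  | Fin of seq 'I_N
  | Inf of (nat -> 'I_N).

(* [None] stands for infinite length. *)
Definition wlength N (w : word N) : option nat :=
  match w with Fin s => Some (size s) | Inf _ => None end.

Definition wfirst N (w : word N) : option 'I_N :=
  match w with Fin s => ohead s | Inf u => Some (u 0%N) end.

Definition Zpairs N : set (word N * word N) :=
  [set p | [/\ wlength p.1 = wlength p.2, wlength p.1 <> Some 0%N &
               wfirst p.1 <> wfirst p.2]].

(* f_(i_1 ... i_n) = phi_(i_n) \o ... \o phi_(i_1). *)
Definition fword N (Phi : IFS N) (s : seq 'I_N) : R -> R :=
  foldl (fun g i => Phi i \o g) id s.

Definition preschwarzian (f : R -> R) : R -> R :=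
  fun x => derive1n 2 f x / derive1 f x.

Definition schwarzian (f : R -> R) : R -> R :=
  fun x => derive1 (preschwarzian f) x - 2^-1 * preschwarzian f x ^+ 2.

(* Any two uniform limits agree on A; their values outside A are arbitrary and
   are never used below. *)
Definition uniform_lim (A : set R) (h : nat -> R -> R) : R -> R :=
  get [set g : R -> R | {uniform A, h @ \oo --> g}].

Definition wordproj (D : (R -> R) -> R -> R) (Omega : set R) N
    (Phi : IFS N) (w : word N) : R -> R :=
  match w with
  | Fin s => D (fword Phi s)
  | Inf u =>
      uniform_lim (closure Omega) (fun n => D (fword Phi (mkseq u n)))
  end.

Definition Tword := wordproj preschwarzian.
Definition Sword := wordproj schwarzian.

Definition GT (Omega Omega' : set R) (N : nat) : set (IFS N) :=
  [set Phi : IFS N | @cifs Omega Omega' N Phi /\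
    0 < inf [set supnorm (closure Omega)
                   (Tword Omega Phi p.1 \- Tword Omega Phi p.2)
            | p in @Zpairs N]].

Definition GS (Omega Omega' : set R) (N : nat) : set (IFS N) :=
  [set Phi : IFS N | @cifs Omega Omega' N Phi /\
    0 < inf [set supnorm (closure Omega)
                   (Sword Omega Phi p.1 \- Sword Omega Phi p.2)
            | p in @Zpairs N]].

End CIFS.

Arguments cifs {R} Omega Omega' N.
Arguments GT {R} Omega Omega' N.
Arguments GS {R} Omega Omega' N.

(* Main.v *)
Require Import Defs.
From mathcomp Require Import all_boot all_order all_algebra.
From mathcomp Require Import all_classical all_reals all_analysis.
From mathcomp Require Import ring lra.
Import Order.TTheory GRing.Theory Num.Theory.
Import numFieldNormedType.Exports.
Set Implicit Arguments.
Unset Strict Implicit.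
Unset Printing Implicit Defensive.
Local Open Scope classical_set_scope.
Local Open Scope ring_scope.

(**
A single perturbation serves for T and S.  Since every phi_i maps the closed
interval [a, b] into its interior, a one-sided neighbourhood of a is never
visited again after the first step.  Replace phi_i by h_i \o phi_i with
[h_i' \o phi_i = 1 + (t_i / k) u_i^k], where k is even and large, u_i is the affine
function of phi_i decreasing in x from u_i(a) = 1, and t_i = beta (i + 1) is
small.  As k grows, this changes phi_i by O(t_i) in the C^2 norm, and
nonvanishing of the derivative survives on the whole extension domain because k
is even.  The change of T is about t_i u_i'(a) at a and exponentially small away
from a, and the change of S at a is about t_i k u_i'(a)^2.

The cocycle identities [T_(iw) = T_i + (T_w \o psi_i) psi_i'] and
[S_(iw) = S_i + (S_w \o psi_i) psi_i'^2] evaluate the tail w only on the image of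
psi_i, that is away from a, where T_w and S_w are bounded and T_w is Lipschitz,
uniformly in w and k.  So the first letter can be read off from S_w(a), and from
T_w(a) - T_w(x) for a point x close to a fixed before k.  Infinite words follow
by passing to the limit.
*)

(** * Real-analytic functions *)

(** Analytic maps admit no cut-off, so a high power, peaked at an endpoint that later steps stay
    away from, plays the part of a bump function. The division by k strikes a balance: it is used up
    by the second derivative of the map, which d_2 controls, so the third derivative is free to grow
    with k. That is why S_w(a) alone separates letters: its gap of order k beats every bounded
    error. T involves no third derivative, so its change stays of order t_i and cannot beat the
    bounded but unknown tail T_w(psi_i(a)) psi_i'(a). Subtracting the value at a nearby x cancels
    that tail up to a Lipschitz error, while the power is negligible at x.

    The scale Lam is common to all letters, so that u_i'(a) = -1/Lam does not depend on i: gaps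
    between the t_i become gaps between the jumps, whatever the unperturbed maps are.

    The order of choice matters: bounds of the unperturbed system, then beta, then bounds valid for
    every k, then x, and k last. Bounds valid for every k exist because k u^k <= 1 / (1 - u) for 0
    <= u < 1. *)

Section RealAnalytic.
Variable R : realType.
Implicit Types (D : set R) (f g : R -> R) (a b : R^nat) (x q t r K M : R).

(** Each of the first n powers of t is at least t^n, and their sum telescopes against 1 - t. Besides
    power series, this serves the bounds that are uniform in the exponent of the perturbation. *)
Lemma natmul_expr_le1 t n : 0 <= t < 1 -> n%:R * t ^+ n * (1 - t) <= 1.
Proof.
move=> /andP[t0 t1].
have h : n%:R * t ^+ n <= \sum_(i < n) t ^+ i.
  rewrite -{1}(card_ord n) mulr_natl -sumr_const; apply: ler_sum => i _.
  by apply: ler_wiXn2l => //; [exact: ltW|exact: ltnW].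
apply: (@le_trans _ _ ((\sum_(i < n) t ^+ i) * (1 - t))).
  by rewrite ler_wpM2r// subr_ge0 ltW.
have -> : (\sum_(i < n) t ^+ i) * (1 - t) = 1 - t ^+ n.
  by rewrite -[RHS]opprB subrX1; ring.
by rewrite gerBl exprn_ge0.
Qed.

(** With s midway between t and 1, the factor n is absorbed by s^n, and the ratio t / s < 1 remains
    as geometric decay. *)
Lemma natmul_expr_le_geometric t n : 0 <= t < 1 ->
  n%:R * t ^+ n <= geometric (2 / (1 - t)) (t / ((1 + t) / 2)) n.
Proof.
move=> /andP[t0 t1]; set s := (1 + t) / 2 => /=.
have s0 : 0 < s by rewrite /s; lra.
have s1 : s < 1 by rewrite /s; lra.
have h : n%:R * s ^+ n <= 2 / (1 - t).
  have -> : 2 / (1 - t) = (1 - s)^-1.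
    have -> : 1 - s = (1 - t) / 2 by rewrite /s; field.
    by rewrite invf_div.
  by rewrite -[leRHS]mul1r ler_pdivlMr ?subr_gt0// natmul_expr_le1// ltW.
have -> : n%:R * t ^+ n = (n%:R * s ^+ n) * (t / s) ^+ n.
  by rewrite -mulrA -exprMn (mulrC t) mulrA divff ?mul1r// gt_eqF.
by rewrite ler_wpM2r// exprn_ge0// divr_ge0// ltW.
Qed.

Lemma ratio_lt1 t : 0 <= t < 1 -> `|t / ((1 + t) / 2)| < 1.
Proof.
move=> /andP[t0 t1].
have ? : 0 < (1 + t) / 2 by lra.
rewrite ger0_norm; last by rewrite divr_ge0// ltW.
by rewrite ltr_pdivrMr// mul1r; lra.
Qed.

Lemma cvg_natmul_expr t : 0 <= t < 1 -> (fun n => n%:R * t ^+ n) @ \oo --> (0 : R).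
Proof.
move=> t01.
apply: (@squeeze_cvgr _ _ _ _ (fun=> 0) (geometric (2 / (1 - t)) (t / ((1 + t) / 2)))).
- apply: nearW => n; rewrite natmul_expr_le_geometric// andbT.
  by rewrite mulr_ge0// exprn_ge0//; case/andP: t01.
- exact: cvg_cst.
- exact/cvg_geometric/ratio_lt1.
Qed.

Lemma pseries_coef_bound a K : cvgn (pseries a K) ->
  exists2 M : R, 0 <= M & forall n, `|a n| * `|K| ^+ n <= M.
Proof.
move=> /cvg_series_bounded[M [_ HM]]; exists (`|M| + 1); first by rewrite addr_ge0.
move=> n; rewrite -normrX -normrM; apply: HM => //.
by rewrite (le_lt_trans (ler_norm _))// ltrDl.
Qed.

Lemma cvg_pseries_diffs a K x : cvgn (pseries a K) -> `|x| < `|K| ->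
  cvgn (pseries (pseries_diffs a) x).
Proof.
move=> /pseries_coef_bound[M M0 HM] xK.
have K0 : 0 < `|K| by exact: le_lt_trans xK.
pose t : R := `|x| / `|K|.
have t01 : 0 <= t < 1.
  by rewrite /t divr_ge0//= ltr_pdivrMr// mul1r.
apply: normed_cvg.
(* The majorant for nonzero x divides by [|x|], so the centre is treated apart. *)
have [->|x0] := eqVneq x 0.
  apply: (@series_le_cvg _ _ (geometric `|a 1%N| 0)).
  - by move=> n /=.
  - by move=> n /=; rewrite mulr_ge0// exprn_ge0.
  - move=> n; rewrite /pseries_diffs /= normrM normrX normr0.
    by case: n => [|n]; rewrite ?mul1r// exprS !mul0r !mulr0.
  - by apply: is_cvg_geometric_series; rewrite normr0.
apply: (@series_le_cvg _ _ (fun n => geometric (M / `|x| * (2 / (1 - t)) *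
      (t / ((1 + t) / 2))) (t / ((1 + t) / 2)) n)).
- by move=> n /=.
- move=> n /=; have /andP[t0 t1] := t01.
  have s0 : 0 <= t / ((1 + t) / 2) by rewrite divr_ge0//; lra.
  by rewrite !mulr_ge0// ?exprn_ge0// ?invr_ge0//; lra.
- move=> n; rewrite /pseries_diffs /=.
  have := @natmul_expr_le_geometric t n.+1 t01 => /= hg.
  rewrite -[leRHS]mulrA -exprS -[leRHS]mulrA.
  apply: (@le_trans _ _ ((M / `|x|) * (n.+1%:R * t ^+ n.+1))); last first.
    by rewrite ler_wpM2l// divr_ge0.
  rewrite !normrM normrX normr_nat /t expr_div_n exprS.
  have nx : `|x| != 0 by rewrite normr_eq0.
  have nK : `|K| ^+ n.+1 != 0 by rewrite expf_neq0// gt_eqF.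
  rewrite [leRHS](_ : _ = n.+1%:R * `|x| ^+ n * (M / `|K| ^+ n.+1)); last first.
    by field; rewrite nx nK.
  rewrite -!mulrA ler_wpM2l// mulrC ler_wpM2l ?exprn_ge0//.
  by rewrite ler_pdivlMr ?exprn_gt0.
- exact/is_cvg_geometric_series/ratio_lt1.
Qed.

Lemma is_derive_pseries a f (x0 : R) r x :
  (forall x, `|x - x0| < r -> pseries a (x - x0) @ \oo --> f x) ->
  `|x - x0| < r ->
  is_derive x 1 f (limn (pseries (pseries_diffs a) (x - x0))).
Proof.
move=> fa xr.
have r0 : 0 < r by exact: le_lt_trans xr.
pose d : R := `|x - x0|.
(* Each termwise differentiation costs a strictly smaller radius: the series converges at [K 3], its
   derived series at [K 2], the second derived series at [K 1], and [K 0] is the distance of x from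
   the centre. *)
pose K (i : nat) : R := d + i%:R / 4 * (r - d).
have dr : 0 < r - d by rewrite subr_gt0.
have d0 : 0 <= d by exact: normr_ge0.
have Kr (i : nat) : (i < 4)%N -> `|K i| < r.
  move=> i4; have ? : i%:R < 4 :> R by rewrite ltr_nat.
  rewrite ger0_norm /K; last by rewrite addr_ge0// mulr_ge0// ?divr_ge0// ltW.
  by rewrite -ltrBrDl -[ltRHS]mul1r ltr_pM2r// ltr_pdivrMr// mul1r.
have K0 i : 0 <= K i by rewrite /K addr_ge0// mulr_ge0// ?divr_ge0// ltW.
have KK i : `|K i| < `|K i.+1|.
  by rewrite !ger0_norm// /K ltrD2l ltr_pM2r// ltr_pM2r ?invr_gt0// ltr_nat.
have dK : `|x - x0| < `|K 1%N|.
  by rewrite [in ltRHS]ger0_norm// /K -/d ltrDl mulr_gt0.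
have c3 : cvgn (pseries a (K 3)).
  apply: (cvgP (f (x0 + K 3))).
  have -> : K 3 = (x0 + K 3) - x0 by ring.
  by rewrite [X in _ --> f X](_ : _ = x0 + K 3); [apply: fa; rewrite addrC addKr Kr|ring].
have c2 : cvgn (pseries (pseries_diffs a) (K 2)) by exact: cvg_pseries_diffs c3 _.
have c1 : cvgn (pseries (pseries_diffs (pseries_diffs a)) (K 1%N)).
  exact: cvg_pseries_diffs c2 _.
have := @pseries_snd_diffs _ a (K 1%N) (x - x0)
  (is_cvg_pseries_inside (is_cvg_pseries_inside c3 (KK 2)) (KK 1%N))
  (is_cvg_pseries_inside c2 (KK 1%N)) c1 dK.
move=> h.
have h2 : is_derive x 1 ((fun y => limn (pseries a y)) \o (fun y => y - x0))
   (limn (pseries (pseries_diffs a) (x - x0)) * 1).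
  apply: is_derive1_comp.
  by apply: is_derive_eq; rewrite subr0.
rewrite mulr1 in h2.
apply: near_eq_is_derive h2.
apply: filterS (nbhsx_ballx x (r - d) dr) => y.
rewrite /ball /= distrC => yx.
apply: cvg_lim => //; apply: fa.
rewrite (_ : y - x0 = (y - x) + (x - x0)); last by ring.
by rewrite (le_lt_trans (ler_normD _ _))// -/d -ltrBrDr.
Qed.

Lemma real_analytic_derivable D f x :
  real_analytic D f -> D x -> derivable f x 1.
Proof.
move=> fD /fD[a [r [r0 fa]]].
have xr : `|x - x| < r by rewrite subrr normr0.
by have [] := is_derive_pseries fa xr.
Qed.

Lemma real_analytic_derive1 D f : real_analytic D f -> real_analytic D (derive1 f).
Proof.
move=> fD x0 /fD[a [r [r0 fa]]]; exists (pseries_diffs a), r; split => // x xr.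
have dfx := is_derive_pseries fa xr.
rewrite derive1E derive_val; pose K : R := (`|x - x0| + r) / 2.
have K0 : 0 <= K by rewrite /K divr_ge0// addr_ge0// ltW.
have xK : `|x - x0| < `|K| by rewrite (ger0_norm K0) /K ltr_pdivlMr//; lra.
have Kr : `|K| < r by rewrite (ger0_norm K0) /K ltr_pdivrMr//; lra.
suff ca : cvgn (pseries a K) by exact: cvg_pseries_diffs ca xK.
apply: (cvgP (f (x0 + K))).
have {1}-> : K = (x0 + K) - x0 by ring.
by apply: fa; rewrite addrC addKr.
Qed.

Lemma real_analytic_cst D (c : R) : real_analytic D (fun=> c).
Proof.
move=> x0 _; exists (fun n => if n is 0 then c else 0), 1; split => // x _.
apply: (@cvg_near_cst _ _ _ _ _ _ _); exists 1%N => // n /= n1.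
rewrite /pseries /series /= -(subnK n1) addn1 big_nat_recl//= expr0 mulr1.
by rewrite big1 ?addr0// => i _; rewrite mul0r.
Qed.

Lemma real_analyticD D f g : real_analytic D f -> real_analytic D g ->
  real_analytic D (fun x => f x + g x).
Proof.
move=> fD gD x0 Dx0.
have [a [r [r0 fa]]] := fD _ Dx0; have [b [s [s0 gb]]] := gD _ Dx0.
exists (fun n => a n + b n), (Num.min r s).
split => [|x]; first by rewrite lt_min r0.
rewrite lt_min => /andP[xr xs].
rewrite (_ : pseries _ _ = (fun n => pseries a (x - x0) n + pseries b (x - x0) n)).
  by apply: cvgD; [exact: fa|exact: gb].
apply/funext => n; rewrite /pseries /series /= -big_split /=.
by apply: eq_bigr => i _; rewrite mulrDl.
Qed.

Definition cauchy_prod a b : R^nat := fun n => \sum_(i < n.+1) a i * b (n - i)%N.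

(** The product of the nth partial sums is a product of polynomials whose coefficients below degree
    n are exactly those of the Cauchy product. The error is therefore the block of degrees from n to
    2n, which has size at most 2 M L n^2 t^n. *)
Lemma cvg_cauchy_prod a b K x (A B : R) : cvgn (pseries a K) -> cvgn (pseries b K) ->
  `|x| < `|K| -> pseries a x @ \oo --> A -> pseries b x @ \oo --> B ->
  pseries (cauchy_prod a b) x @ \oo --> A * B.
Proof.
move=> /pseries_coef_bound[M M0 aM] /pseries_coef_bound[L L0 bL] xK aA bB.
have K0 : 0 < `|K| by exact: le_lt_trans xK.
pose t : R := `|x| / `|K|.
have t01 : 0 <= t < 1 by rewrite /t divr_ge0//= ltr_pdivrMr// mul1r.
have /andP[t0 t1] := t01.
have xt n : `|x| ^+ n = t ^+ n * `|K| ^+ n.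
  by rewrite -exprMn /t divfK// gt_eqF.
pose p n : {poly R} := \poly_(i < n) a i; pose q n : {poly R} := \poly_(i < n) b i.
have pE n : pseries a x n = (p n).[x].
  by rewrite /pseries /series /= horner_poly big_mkord.
have qE n : pseries b x n = (q n).[x].
  by rewrite /pseries /series /= horner_poly big_mkord.
have pb n i : `|(p n)`_i| * `|K| ^+ i <= M.
  by rewrite coef_poly; case: ifP => _ //; rewrite normr0 mul0r.
have qb n i : `|(q n)`_i| * `|K| ^+ i <= L.
  by rewrite coef_poly; case: ifP => _ //; rewrite normr0 mul0r.
pose s : R := (1 + t) / 2; pose u : R := t / s.
have pqE n : (p n * q n).[x] = pseries (cauchy_prod a b) x n +
    \sum_(n <= i < n + n) (p n * q n)`_i * x ^+ i.
  rewrite (@horner_coef_wide _ (n + n)); last first.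
    rewrite (leq_trans (size_polyMleq _ _))// (leq_trans (leq_pred _))//.
    by rewrite leq_add// size_poly.
  rewrite -(big_mkord xpredT (fun i => (p n * q n)`_i * x ^+ i)).
  rewrite (@big_cat_nat _ _ _ n)//= ?leq_addr//; congr (_ + _).
  rewrite /pseries /series /= !big_mkord; apply: eq_bigr => i _; congr (_ * _).
  rewrite coefM; apply: eq_bigr => j _; rewrite !coef_poly.
  rewrite (leq_trans (ltn_ord j))//.
  by rewrite (leq_ltn_trans (leq_subr _ _)).
have cb n i : `|(p n * q n)`_i * x ^+ i| <= M * L * (i.+1%:R * t ^+ i).
  rewrite normrM normrX xt.
  rewrite [leLHS](_ : _ = t ^+ i * (`|K| ^+ i * `|(p n * q n)`_i|)); last by ring.
  rewrite [leRHS](_ : _ = t ^+ i * (M * L * i.+1%:R)); last by ring.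
  rewrite ler_wpM2l ?exprn_ge0// coefM.
  apply: (@le_trans _ _ (\sum_(j < i.+1) M * L)); last first.
    by rewrite sumr_const card_ord mulr_natr.
  apply: (le_trans (ler_wpM2l _ (ler_norm_sum _ _ _))); first exact: exprn_ge0.
  rewrite mulr_sumr; apply: ler_sum => j _; rewrite normrM.
  have -> : `|K| ^+ i = `|K| ^+ j * `|K| ^+ (i - j).
    by rewrite -exprD subnKC// -ltnS ltn_ord.
  by rewrite mulrC mulrACA ler_pM// mulr_ge0// exprn_ge0.
(* The square root turns n^2 t^n into (n w^n)^2, a product of two null sequences. *)
pose w : R := Num.sqrt t.
have w2 : w ^+ 2 = t by rewrite sqr_sqrtr.
have w01 : 0 <= w < 1 by rewrite sqrtr_ge0/= -sqrtr1 ltr_sqrt.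
pose e n := 2 * M * L * ((n%:R * w ^+ n) * (n%:R * w ^+ n)).
have tail n : `|\sum_(n <= i < n + n) (p n * q n)`_i * x ^+ i| <= e n.
  apply: (le_trans (ler_norm_sum _ _ _)).
  apply: (@le_trans _ _ (\sum_(n <= i < n + n) M * L * ((n + n)%:R * t ^+ n))).
    apply: ler_sum_nat => i /andP[ni inn].
    apply: (le_trans (cb _ _)); rewrite ler_wpM2l ?mulr_ge0// ler_pM// ?exprn_ge0//.
      by rewrite ler_nat.
    by rewrite ler_wiXn2l// ltW.
  rewrite sumr_const_nat addnK /e -w2 -mulr_natr natrD exprAC.
  by rewrite le_eqVlt; apply/orP; left; apply/eqP; ring.
have e0 : e @ \oo --> (0 : R).
  rewrite -(mulr0 (2 * M * L)) -[X in _ * X](mulr0 0).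
  by apply: cvgM; [exact: cvg_cst|apply: cvgM; exact: cvg_natmul_expr].
have tail0 : (fun n => \sum_(n <= i < n + n) (p n * q n)`_i * x ^+ i) @ \oo --> (0 : R).
  apply: (@squeeze_cvgr _ _ _ _ (fun n => - e n) e); last 2 first.
    by rewrite -oppr0; apply: cvgN.
    by [].
  by apply: nearW => n; rewrite -ler_norml.
have -> : pseries (cauchy_prod a b) x = (fun n => pseries a x n * pseries b x n -
    \sum_(n <= i < n + n) (p n * q n)`_i * x ^+ i).
  by apply/funext => n; rewrite pE qE -hornerM pqE addrK.
by rewrite -[A * B]subr0; apply: cvgB => //; apply: cvgM.
Qed.

Lemma real_analyticM D f g : real_analytic D f -> real_analytic D g ->
  real_analytic D (fun x => f x * g x).
Proof.
move=> fD gD x0 Dx0.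
have [a [r [r0 fa]]] := fD _ Dx0; have [b [s [s0 gb]]] := gD _ Dx0.
exists (cauchy_prod a b), (Num.min r s).
split => [|x]; first by rewrite lt_min r0.
rewrite lt_min => /andP[xr xs].
pose d : R := `|x - x0|.
have [K [K0 xK Kr Ks]] : exists K : R, [/\ 0 <= K, d < K, K < r & K < s].
  exists ((d + Num.min r s) / 2).
  have d0 : 0 <= d by exact: normr_ge0.
  have dr : d < r := xr; have ds : d < s := xs.
  by rewrite /Num.min; case: ifP => rs; split; lra.
have cvgK (c : R^nat) (h : R -> R) (v : R) : K < v ->
    (forall x, `|x - x0| < v -> pseries c (x - x0) @ \oo --> h x) -> cvgn (pseries c K).
  move=> Kv hc; apply: (cvgP (h (x0 + K))).
  have {1}-> : K = (x0 + K) - x0 by ring.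
  by apply: hc; rewrite addrC addKr ger0_norm.
apply: (@cvg_cauchy_prod _ _ K).
- exact: cvgK fa.
- exact: cvgK gb.
- by rewrite (ger0_norm K0).
- exact: fa.
- exact: gb.
Qed.

Lemma real_analyticX D f n : real_analytic D f -> real_analytic D (fun x => f x ^+ n).
Proof.
move=> fD; elim: n => [|n IH].
  exact: real_analytic_cst.
rewrite (_ : (fun _ => _) = (fun x => f x * f x ^+ n)); last by apply/funext => x; rewrite exprS.
exact: real_analyticM.
Qed.

End RealAnalytic.

(** * Calculus of the pre-Schwarzian and Schwarzian derivatives *)

Section Calculus.
Variable R : realType.
Implicit Types (f g : R -> R) (x y : R).

Lemma derivable_is_derive f x : derivable f x 1 -> is_derive x 1 f (derive1 f x).
Proof. by move=> fx; rewrite derive1E; exact/derivableP. Qed.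

Lemma is_derive_derive1 f x (d : R) : is_derive x 1 f d -> derive1 f x = d.
Proof. by move=> fx; rewrite derive1E derive_val. Qed.

Lemma is_derive_derivable f x (d : R) : is_derive x 1 f d -> derivable f x 1.
Proof. by case. Qed.

(** The differentiation rules are restated for functions written pointwise, so that the derivative
    of an explicit formula can be assembled as a term. *)
Lemma is_derive_fun_cst (c x : R) : is_derive x 1 (fun=> c) (0 : R).
Proof. exact: is_derive_cst. Qed.

Lemma is_derive_fun_id x : is_derive x 1 (fun y : R => y) (1 : R).
Proof. exact: is_derive_id. Qed.

Lemma is_derive_fun_add f g x (df dg : R) : is_derive x 1 f df -> is_derive x 1 g dg ->
  is_derive x 1 (fun y => f y + g y) (df + dg).
Proof. by move=> hf hg; exact: is_deriveD. Qed.

Lemma is_derive_fun_mul f g x (df dg : R) : is_derive x 1 f df -> is_derive x 1 g dg ->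
  is_derive x 1 (fun y => f y * g y) (df * g x + f x * dg).
Proof.
move=> hf hg; apply: (is_derive_eq (@is_deriveM _ _ f g x 1 df dg hf hg)).
by rewrite /= /GRing.scale /= addrC mulrC.
Qed.

Lemma is_derive_fun_inv f x (df : R) : f x != 0 -> is_derive x 1 f df ->
  is_derive x 1 (fun y => (f y)^-1) (- df / f x ^+ 2).
Proof.
move=> f0 hf; refine (is_derive_eq (is_deriveV f0 hf) _).
by rewrite /GRing.scale /= !mulNr mulrC.
Qed.

Lemma is_derive_fun_div f g x (df dg : R) : g x != 0 ->
  is_derive x 1 f df -> is_derive x 1 g dg ->
  is_derive x 1 (fun y => f y / g y) ((df * g x - f x * dg) / g x ^+ 2).
Proof.
move=> g0 hf hg.
refine (is_derive_eq (is_derive_fun_mul hf (is_derive_fun_inv g0 hg)) _).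
by field.
Qed.

Lemma is_derive_fun_exp f x (df : R) n : is_derive x 1 f df ->
  is_derive x 1 (fun y => f y ^+ n.+1) (n.+1%:R * f x ^+ n * df).
Proof.
move=> hf; elim: n => [|n IH].
  by rewrite expr0 !mul1r.
rewrite (_ : (fun y => _) = (fun y => f y * f y ^+ n.+1)); last first.
  by apply/funext => y; rewrite exprS.
refine (is_derive_eq (is_derive_fun_mul hf IH) _).
by rewrite -[in RHS]natr1 exprS; ring.
Qed.

Lemma is_derive_fun_comp f g x (df dg : R) : is_derive (f x) 1 g dg -> is_derive x 1 f df ->
  is_derive x 1 (fun y => g (f y)) (dg * df).
Proof. by move=> hg hf; exact: is_derive1_comp. Qed.

Lemma is_derive_cvg f x (d : R) : is_derive x 1 f d -> f y @[y --> x] --> f x.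
Proof.
by move=> /is_derive_derivable/derivable1_diffP/differentiable_continuous.
Qed.

Lemma near_derive1 f g x : (\forall y \near x, f y = g y) ->
  \forall y \near x, derive1 f y = derive1 g y.
Proof.
move=> /near_join; apply: filterS => y fg.
by rewrite !derive1E; exact: near_eq_derive.
Qed.

Lemma derive1_open (D : set R) f g : open D -> (forall x, D x -> f x = g x) ->
  forall x, D x -> derive1 f x = derive1 g x.
Proof.
move=> oD fg x Dx; apply: (@nbhs_singleton _ x (fun y => derive1 f y = derive1 g y)).
apply: near_derive1.
have : nbhs x D by exact: open_nbhs_nbhs.
by apply: filterS => y; exact: fg.
Qed.

Lemma mvt_lipschitz f (f' : R -> R) (a b L : R) :
  (forall x, a <= x <= b -> is_derive x 1 f (f' x)) ->
  (forall x, a <= x <= b -> `|f' x| <= L) ->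
  forall x y, a <= x <= b -> a <= y <= b -> `|f x - f y| <= L * `|x - y|.
Proof.
move=> df fL x y.
wlog xy : x y / x <= y.
  move=> W xab yab; have [xy|/ltW yx] := leP x y; first exact: W.
  by rewrite distrC (distrC x); exact: W.
move=> /andP[ax xb] /andP[ay yb].
have dxy z : z \in `[x, y] -> is_derive z 1 f (f' z).
  rewrite in_itv/= => /andP[xz zy]; apply: df.
  by rewrite (le_trans ax)//= (le_trans zy).
have doo z : z \in `]x, y[ -> is_derive z 1 f (f' z).
  by move=> zoo; apply: dxy; exact: subset_itv_oo_cc zoo.
have cxy : {within `[x, y], continuous f}.
  by apply: derivable_within_continuous => z /dxy; exact: is_derive_derivable.
have [z zxy e] := MVT_segment xy doo cxy.
rewrite distrC e normrM (distrC y) ler_wpM2r// fL//.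
move: zxy; rewrite in_itv/= => /andP[xz zy].
by rewrite (le_trans ax)//= (le_trans zy).
Qed.

Lemma continuous_bounded_segment f (a b : R) : a <= b ->
  (forall x, a <= x <= b -> f y @[y --> x] --> f x) ->
  exists2 M : R, 0 <= M & forall x, a <= x <= b -> `|f x| <= M.
Proof.
move=> ab cf.
have cf' : {within `[a, b], continuous (fun x => `|f x|)}.
  apply: continuous_in_subspaceT => x; rewrite inE/= in_itv/= => xab.
  by apply: cvg_norm; exact: cf.
have [c _ hc] := EVT_max ab cf'.
by exists `|f c| => // x xab; apply: hc; rewrite in_itv.
Qed.

End Calculus.

(** * Chain rules for T and S along words *)

Section Germs.
Variable R : realType.
Implicit Types (f g : R -> R) (x y : R).

(** Three derivatives are what S consumes. The condition holds on a neighbourhood because an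
    identity between functions can be differentiated only if it holds near the point. *)
Definition immersive_near f x := \forall y \near x,
  [/\ derivable f y 1, derivable (derive1 f) y 1,
      derivable (derive1 (derive1 f)) y 1 & derive1 f y != 0].

Lemma immersive_near_nbhs f x : immersive_near f x ->
  \forall y \near x, immersive_near f y.
Proof. exact: near_join. Qed.

Lemma immersive_near_id x : immersive_near id x.
Proof.
have d1 : derive1 (id : R -> R) = (fun=> 1).
  by apply/funext => y; apply: is_derive_derive1; exact: is_derive_fun_id.
have d2 : derive1 ((fun=> 1) : R -> R) = (fun=> 0).
  by apply/funext => y; apply: is_derive_derive1; exact: is_derive_fun_cst.
rewrite /immersive_near; near=> y; rewrite d1 d2 oner_eq0.
by split.
Unshelve. all: by end_near. Qed.

Lemma is_derive_preschwarzian f x : immersive_near f x ->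
  is_derive x 1 (preschwarzian f) (derive1 (preschwarzian f) x).
Proof.
move=> /nbhs_singleton[_ d2 d3 f0]; apply/derivable_is_derive.
exact: is_derive_derivable
  (is_derive_fun_div f0 (derivable_is_derive d3) (derivable_is_derive d2)).
Qed.

Section Composition.
Variables (f g : R -> R) (x : R).
Hypotheses (fx : immersive_near f x) (gfx : immersive_near g (f x)).

Let fg_near : \forall y \near x, immersive_near f y /\ immersive_near g (f y).
Proof.
have fc : f y @[y --> x] --> f x.
  by have [/derivable_is_derive/is_derive_cvg] := nbhs_singleton fx.
have gfy : \forall y \near x, immersive_near g (f y) := fc _ (immersive_near_nbhs gfx).
near=> y; split; near: y => //; exact: immersive_near_nbhs.
Unshelve. all: by end_near.
Qed.

(** The chain rule is kept as an equality of germs, so that it can be differentiated again for the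
    second derivative. *)
Lemma near_derive1_comp :
  \forall y \near x, derive1 (g \o f) y = derive1 g (f y) * derive1 f y.
Proof.
apply: filterS fg_near => y [fy gy].
have [f1 _ _ _] := nbhs_singleton fy; have [g1 _ _ _] := nbhs_singleton gy.
apply: is_derive_derive1.
exact: (is_derive_fun_comp (derivable_is_derive g1) (derivable_is_derive f1)).
Qed.

Lemma near_derive2_comp :
  \forall y \near x, derive1 (derive1 (g \o f)) y =
    derive1 (derive1 g) (f y) * derive1 f y * derive1 f y +
    derive1 g (f y) * derive1 (derive1 f) y.
Proof.
have := near_derive1 near_derive1_comp.
apply: filterS2 fg_near => y [fy gy] ->.
have [f1 f2 _ _] := nbhs_singleton fy; have [g1 g2 _ _] := nbhs_singleton gy.
apply: is_derive_derive1.
exact: (is_derive_fun_mul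
  (is_derive_fun_comp (derivable_is_derive g2) (derivable_is_derive f1))
  (derivable_is_derive f2)).
Qed.

Lemma immersive_near_comp : immersive_near (g \o f) x.
Proof.
have E1 := near_join near_derive1_comp; have E2 := near_join near_derive2_comp.
rewrite /immersive_near; near=> y.
have [fy gy] : immersive_near f y /\ immersive_near g (f y) by near: y; exact: fg_near.
have e1 : \forall z \near y, derive1 (g \o f) z = derive1 g (f z) * derive1 f z.
  by near: y; exact: E1.
have e2 : \forall y \near y, derive1 (derive1 (g \o f)) y =
    derive1 (derive1 g) (f y) * derive1 f y * derive1 f y +
    derive1 g (f y) * derive1 (derive1 f) y.
  by near: y; exact: E2.
have [/derivable_is_derive f1 /derivable_is_derive f2 /derivable_is_derive f3 f0] :=
  nbhs_singleton fy.
have [/derivable_is_derive g1 /derivable_is_derive g2 /derivable_is_derive g3 g0] :=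
  nbhs_singleton gy.
have g1f := is_derive_fun_comp g2 f1; have g2f := is_derive_fun_comp g3 f1.
split.
- exact: (is_derive_derivable (is_derive_fun_comp g1 f1)).
- apply: (@near_eq_derivable _ _ _ (fun z => derive1 g (f z) * derive1 f z)).
    by apply: filterS e1 => z ->.
  exact: (is_derive_derivable (is_derive_fun_mul g1f f2)).
- apply: (@near_eq_derivable _ _ _ (fun z =>
    derive1 (derive1 g) (f z) * derive1 f z * derive1 f z +
    derive1 g (f z) * derive1 (derive1 f) z)).
    by apply: filterS e2 => z ->.
  apply: is_derive_derivable (is_derive_fun_add (is_derive_fun_mul
    (is_derive_fun_mul g2f f2) f2) (is_derive_fun_mul g1f f3)).
- by rewrite (nbhs_singleton e1) mulf_neq0.
Unshelve. all: by end_near. Qed.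

Lemma near_preschwarzian_comp : \forall y \near x, preschwarzian (g \o f) y =
  preschwarzian f y + preschwarzian g (f y) * derive1 f y.
Proof.
near=> y; rewrite /preschwarzian /=.
have [/nbhs_singleton[_ _ _ f0] /nbhs_singleton[_ _ _ g0]] :
  immersive_near f y /\ immersive_near g (f y) by near: y; exact: fg_near.
rewrite (near near_derive1_comp y)// (near near_derive2_comp y)//.
have alg (f1 f2 g1 g2 : R) : f1 != 0 -> g1 != 0 ->
    (g2 * f1 * f1 + g1 * f2) / (g1 * f1) = f2 / f1 + g2 / g1 * f1.
  by move=> ? ?; field; apply/andP.
exact: alg.
Unshelve. all: by end_near. Qed.

(** Differentiating the chain rule of T produces the term T_g(f) f''. As f'' = T_f f', it cancels
    the cross term of the square, and no first-order term in T survives. *)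
Lemma schwarzian_comp : schwarzian (g \o f) x =
  schwarzian f x + schwarzian g (f x) * derive1 f x ^+ 2.
Proof.
have [/derivable_is_derive f1 /derivable_is_derive f2 _ f0] := nbhs_singleton fx.
rewrite /schwarzian (nbhs_singleton (near_derive1 near_preschwarzian_comp)).
rewrite (is_derive_derive1 (is_derive_fun_add (is_derive_preschwarzian fx)
  (is_derive_fun_mul (is_derive_fun_comp (is_derive_preschwarzian gfx) f1) f2))).
rewrite (nbhs_singleton near_preschwarzian_comp).
have -> : derive1 (derive1 f) x = preschwarzian f x * derive1 f x.
  by rewrite /preschwarzian /= divfK.
move: (derive1 (preschwarzian f) x) (derive1 (preschwarzian g) (f x)) (preschwarzian f x)
  (preschwarzian g (f x)) (derive1 f x) => *.
by field.
Qed.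

End Composition.

Section Words.
Variables (N : nat) (Phi : IFS R N) (A : set R).
Hypotheses (PhiA : forall i x, A x -> A (Phi i x))
  (Phi_immersive : forall i x, A x -> immersive_near (Phi i) x).

Lemma fword_cons i s : fword Phi (i :: s) = fword Phi s \o Phi i.
Proof.
(* The two compositions with [id] are convertible; the second has the shape to which the induction
   on [s] applies, with the accumulator [id] generalised. *)
rewrite /fword /= -[Phi i \o id]/(id \o Phi i).
elim: s (id) => [|j s IH] h //=.
exact: (IH (Phi j \o h)).
Qed.

Lemma immersive_near_fword s x : A x -> immersive_near (fword Phi s) x.
Proof.
elim: s x => [|i s IH] x Ax; first exact: immersive_near_id.
by rewrite fword_cons; apply: immersive_near_comp; [exact: Phi_immersive|exact/IH/PhiA].
Qed.

Lemma preschwarzian_fword_nil : preschwarzian (fword Phi [::]) = (fun=> 0).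
Proof.
apply/funext => x; rewrite /preschwarzian /fword /=.
have -> : derive1 (id : R -> R) = (fun=> 1).
  by apply/funext => y; apply: is_derive_derive1; exact: is_derive_fun_id.
by rewrite (is_derive_derive1 (is_derive_fun_cst _ _)) mul0r.
Qed.

Lemma schwarzian_fword_nil : schwarzian (fword Phi [::]) = (fun=> 0).
Proof.
apply/funext => x; rewrite /schwarzian preschwarzian_fword_nil.
by rewrite (is_derive_derive1 (is_derive_fun_cst _ _)) expr0n mulr0 subr0.
Qed.

Lemma preschwarzian_fword_cons i s x : A x ->
  preschwarzian (fword Phi (i :: s)) x = preschwarzian (Phi i) x +
    preschwarzian (fword Phi s) (Phi i x) * derive1 (Phi i) x.
Proof.
move=> Ax; rewrite fword_cons.
exact: (nbhs_singleton (near_preschwarzian_comp (Phi_immersive i Ax)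
  (immersive_near_fword s (PhiA i Ax)))).
Qed.

Lemma schwarzian_fword_cons i s x : A x ->
  schwarzian (fword Phi (i :: s)) x = schwarzian (Phi i) x +
    schwarzian (fword Phi s) (Phi i x) * derive1 (Phi i) x ^+ 2.
Proof.
move=> Ax; rewrite fword_cons.
by apply: schwarzian_comp; [exact: Phi_immersive|exact/immersive_near_fword/PhiA].
Qed.

End Words.
End Germs.

(** * Cocycles over words and their limits *)

Section Cocycle.
Variables (R : realType) (N : nat) (A : set R) (psi c g : 'I_N -> R -> R).
Variables (D : seq 'I_N -> R -> R) (rho : R).
Hypotheses (rho01 : 0 <= rho < 1) (psiA : forall i x, A x -> A (psi i x)).
Hypotheses (D_nil : forall x, A x -> D [::] x = 0)
  (D_cons : forall i s x, A x -> D (i :: s) x = c i x + D s (psi i x) * g i x)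
  (g_le : forall i x, A x -> `|g i x| <= rho).

(** The constant is the fixed point of M = B + rho M. The invariant set [Y] allows a bound on [c]
    that holds only on part of [A], such as the points away from the left endpoint. *)
Lemma cocycle_bound (Y : set R) (B : R) : Y `<=` A ->
  (forall i x, Y x -> Y (psi i x)) -> 0 <= B ->
  (forall i x, Y x -> `|c i x| <= B) ->
  forall s x, Y x -> `|D s x| <= B / (1 - rho).
Proof.
case/andP: rho01 => r0 r1 YA psiY B0 cB.
have M0 : 0 <= B / (1 - rho) by rewrite divr_ge0// subr_ge0 ltW.
elim=> [|i s IH] x Yx; first by rewrite D_nil ?normr0//; exact: YA.
rewrite D_cons; last exact: YA.
have -> : B / (1 - rho) = B + B / (1 - rho) * rho.
  by field; rewrite subr_eq0 gt_eqF.
rewrite (le_trans (ler_normD _ _))// lerD ?cB// normrM ler_pM//.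
- exact/IH/psiY.
- exact/g_le/YA.
Qed.

(** The contributions of the common prefix cancel, and each of its letters multiplies the remainder
    by at most [rho]. This makes the projections of prefixes uniformly Cauchy. *)
Lemma cocycle_prefix (M : R) : (forall t x, A x -> `|D t x| <= M) ->
  forall s t x, A x -> `|D (s ++ t) x - D s x| <= rho ^+ size s * M.
Proof.
move=> DM; elim=> [|i s IH] t x Ax /=.
  by rewrite D_nil// subr0 expr0 mul1r DM.
rewrite !D_cons// opprD addrACA subrr add0r -mulrBl normrM exprS -mulrA mulrC.
by rewrite ler_pM// ?g_le// IH//; exact: psiA.
Qed.

(** One more letter turns a Lipschitz constant L into C + L rho + M C, the three terms coming from
    the variation of [c], of the tail and of [g]; the stated constant is the fixed point. *)
Lemma cocycle_lipschitz (Y : set R) (M C : R) : Y `<=` A ->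
  (forall i x, Y x -> Y (psi i x)) -> 0 <= M -> 0 <= C ->
  (forall s x, Y x -> `|D s x| <= M) ->
  (forall i x y, Y x -> Y y -> `|c i x - c i y| <= C * `|x - y|) ->
  (forall i x y, Y x -> Y y -> `|g i x - g i y| <= C * `|x - y|) ->
  (forall i x y, Y x -> Y y -> `|psi i x - psi i y| <= `|x - y|) ->
  forall s x y, Y x -> Y y ->
  `|D s x - D s y| <= (C + M * C) / (1 - rho) * `|x - y|.
Proof.
case/andP: rho01 => r0 r1 YA psiY M0 C0 DM cC gC psi1.
pose L : R := (C + M * C) / (1 - rho); rewrite -/L.
have L0 : 0 <= L.
  by rewrite divr_ge0//; [rewrite addr_ge0// mulr_ge0|rewrite subr_ge0 ltW].
have LE : L = C + (L * rho + M * C).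
  by rewrite /L; field; rewrite subr_eq0 gt_eqF.
elim=> [|i s IH] x y Yx Yy.
  by rewrite !D_nil; [rewrite subrr normr0 mulr_ge0|exact: YA..].
rewrite !D_cons; [|exact: YA..].
rewrite [X in `|X|](_ : _ = (c i x - c i y) + ((D s (psi i x) - D s (psi i y)) * g i x
  + D s (psi i y) * (g i x - g i y))); last by ring.
rewrite LE [leRHS]mulrDl [X in _ <= _ + X]mulrDl (le_trans (ler_normD _ _))// lerD ?cC//.
rewrite (le_trans (ler_normD _ _))// lerD// normrM.
  rewrite mulrAC ler_pM//; last by apply: g_le; exact: YA.
  rewrite (le_trans (IH _ _ _ _))//; try exact: psiY.
  by rewrite ler_wpM2l// psi1.
by rewrite -mulrA ler_pM// ?gC// DM//; exact: psiY.
Qed.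

End Cocycle.

(** * Infinite words as limits, and a criterion for a positive infimum *)

Section WordProjections.
Variable R : realType.

Lemma uniform_cvgP (A : set R) (h : nat -> R -> R) (l : R -> R) :
  {uniform A, h @ \oo --> l} <->
  forall e : R, 0 < e -> \forall n \near \oo, forall x, A x -> `|l x - h n x| < e.
Proof.
split=> [hl e e0|hl].
  have : nbhs (l : {uniform` A -> R}) [set k | forall y, A y -> `|l y - k y| < e].
    apply/uniform_nbhs; exists [set p | ball p.1 e p.2]; split; last by [].
    exact: entourage_ball (PosNum e0).
  by move=> /hl.
move=> P /uniform_nbhs[E [entE EP]].
move: entE; rewrite -entourage_ballE => -[e e0 eE].
apply: filterS (hl e e0) => n hn; apply: EP => y Ay; apply: eE; exact: hn.
Qed.

Lemma supnorm_ge (A : set R) (h : R -> R) (M x : R) :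
  (forall y, A y -> `|h y| <= M) -> A x -> `|h x| <= supnorm A h.
Proof.
move=> hM Ax; apply: ub_le_sup; last by exists x.
by exists M => _ [y Ay <-]; exact: hM.
Qed.

Lemma supnorm_le (A : set R) (h : R -> R) (M : R) : A !=set0 ->
  (forall y, A y -> `|h y| <= M) -> supnorm A h <= M.
Proof.
move=> [x Ax] hM; apply: ge_sup; first by exists `|h x|, x.
by move=> _ [y Ay <-]; exact: hM.
Qed.

(* Constant for a finite word, so that both kinds of words are limits of their
   truncations. *)
Definition truncation N (w : word N) (n : nat) : seq 'I_N :=
  match w with Fin s => s | Inf u => mkseq u n end.

Lemma Zpairs_truncation N (w : word N * word N) n : (0 < n)%N -> Zpairs w ->
  exists i j s t, [/\ i != j, truncation w.1 n = i :: s & truncation w.2 n = j :: t].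
Proof.
case: n => // n _; case: w => [[[|i s]|u] [[|j t]|v]] [] //= _ _ ij.
- by exists i, j, s, t; split => //; apply/eqP => e; apply: ij; rewrite e.
- exists (u 0%N), (v 0%N), (behead (mkseq u n.+1)), (behead (mkseq v n.+1)).
  by split => //; apply/eqP => e; apply: ij; rewrite e.
Qed.

Section Separation.
Variables (N : nat) (Omega : set R) (Phi : IFS R N) (Dop : (R -> R) -> R -> R).
Variables (rho M : R).
Let A := closure Omega.
Let D s := Dop (fword Phi s).
Hypotheses (rho01 : 0 <= rho < 1) (D_le : forall s x, A x -> `|D s x| <= M)
  (D_prefix : forall s t x, A x -> `|D (s ++ t) x - D s x| <= rho ^+ size s * M).

Let cvg_rho : (fun n => rho ^+ n * M) @ \oo --> (0 : R).
Proof.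
rewrite -(mul0r M); apply: cvgM; last exact: cvg_cst.
by apply: cvg_expr; case/andP: rho01 => ? ?; rewrite ger0_norm.
Qed.

Let near_rho (e : R) : 0 < e -> \forall n \near \oo, rho ^+ n * M < e.
Proof.
move=> e0; have /cvgrPdist_lt/(_ e e0) := cvg_rho.
move=> h; apply: filterS h => n; rewrite sub0r normrN.
exact: le_lt_trans (ler_norm _).
Qed.

Lemma uniform_cvg_wordproj (u : nat -> 'I_N) :
  {uniform A, (fun n => D (mkseq u n)) @ \oo --> wordproj Dop Omega Phi (Inf u)}.
Proof.
have cauchy_h (x : R) n m : A x -> (n <= m)%N ->
    `|D (mkseq u m) x - D (mkseq u n) x| <= rho ^+ n * M.
  move=> Ax nm; rewrite -(subnKC nm) /mkseq iotaD map_cat.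
  by have := D_prefix (map u (iota 0 n)) (map u (iota (0 + n) (m - n))) Ax;
    rewrite size_map size_iota.
have cvgh x : A x -> cvgn (fun n => D (mkseq u n) x).
  move=> Ax; apply: cauchy_cvg; apply: cauchy_exP => e e0.
  have [n _ hn] := near_rho e0.
  exists (D (mkseq u n) x); exists n => // m /= nm.
  by rewrite /ball /= distrC (le_lt_trans (cauchy_h x n m Ax nm))// hn/=.
have : [set l : R -> R | {uniform A, (fun n => D (mkseq u n)) @ \oo --> l}] !=set0.
  exists (fun x => limn (fun n => D (mkseq u n) x)); apply/uniform_cvgP => e e0.
  have e2 : 0 < e / 2 by rewrite divr_gt0.
  apply: filterS (near_rho e2) => n hn x Ax.
  have /cvgrPdist_lt/(_ _ e2)[m _ hm] := cvgh x Ax.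
  (* The index [m] depends on [x], but it enters only through the intermediate index [k], so the
     estimate at [n] remains uniform in [x]. *)
  pose k := maxn n m.
  have h1 := hm k (leq_maxr n m).
  have h2 := cauchy_h x n k Ax (leq_maxl n m).
  rewrite -(subrK (D (mkseq u k) x) (limn _)) -addrA (le_lt_trans (ler_normD _ _))//.
  by rewrite (splitr e) ltrD// (le_lt_trans h2).
exact: getPex.
Qed.

Lemma cvg_wordproj w x : A x ->
  D (truncation w n) x @[n --> \oo] --> wordproj Dop Omega Phi w x.
Proof.
case: w => [s|u] Ax /=; first exact: cvg_cst.
apply/cvgrPdist_lt => e e0.
have := (uniform_cvgP _ _ _).1 (@uniform_cvg_wordproj u) e e0.
by move=> h; apply: filterS h => n; exact.
Qed.

Lemma wordproj_le w x : A x -> `|wordproj Dop Omega Phi w x| <= M.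
Proof.
move=> Ax.
have h : `|D (truncation w n) x| @[n --> \oo] --> `|wordproj Dop Omega Phi w x|.
  by apply: cvg_norm; exact: cvg_wordproj.
apply: (closed_cvg (fun y : R => y <= M) (@closed_le _ _) _ _ h).
by apply: nearW => n; exact: D_le.
Qed.

(** The functional h(p) - kappa h(q) is at most twice the sup norm, so a lower bound [e] for it
    gives [e / 2] for the norm. The large inequality passes from truncations to infinite words. The
    value kappa = 1 is meant for T and kappa = 0 for S. *)
Lemma inf_supnorm_gt0 (kappa p q e : R) : (2 <= N)%N -> A p -> A q ->
  `|kappa| <= 1 -> 0 < e ->
  (forall i j s t, i != j -> e <= `|(D (i :: s) p - D (j :: t) p)
     - kappa * (D (i :: s) q - D (j :: t) q)|) ->
  0 < inf [set supnorm (closure Omega)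
     (wordproj Dop Omega Phi w.1 \- wordproj Dop Omega Phi w.2) | w in @Zpairs N].
Proof.
move=> N2 Ap Aq kappa1 e0 sep.
apply: (@lt_le_trans _ _ (e / 2)); first by rewrite divr_gt0.
apply: lb_le_inf.
  (* Two distinct letters make the set nonempty; the real infimum of the empty set would be 0. *)
  pose i0 := Ordinal (ltnW N2); pose i1 := Ordinal N2.
  eexists; exists (Fin [:: i0], Fin [:: i1]); last reflexivity.
  by split.
move=> _ [w Zw <-].
set P := wordproj _ _ _ _; set Q := wordproj _ _ _ _.
have PQM y : A y -> `|(P \- Q) y| <= M + M.
  by move=> Ay; rewrite (le_trans (ler_normB _ _))// lerD// wordproj_le.
have hp := supnorm_ge PQM Ap; have hq := supnorm_ge PQM Aq.
have lim : e <= `|(P \- Q) p - kappa * (P \- Q) q|.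
  have h : (`|(D (truncation w.1 n) p - D (truncation w.2 n) p) - kappa *
      (D (truncation w.1 n) q - D (truncation w.2 n) q)|) @[n --> \oo]
      --> `|(P \- Q) p - kappa * (P \- Q) q|.
    by apply: cvg_norm; apply: cvgB; [|apply: cvgM; first exact: cvg_cst];
      apply: cvgB; exact: cvg_wordproj.
  apply: (closed_cvg (fun y : R => e <= y) (@closed_ge _ _) _ _ h).
  exists 1%N => // n /= n1.
  by have [i [j [s [t [ij -> ->]]]]] := Zpairs_truncation n1 Zw; exact: sep.
rewrite ler_pdivrMr// (le_trans lim)// (le_trans (ler_normB _ _))//.
rewrite mulr_natr mulr2n lerD// normrM -[leRHS]mul1r ler_pM//.
Qed.

End Separation.
End WordProjections.

(** * The perturbation of one map *)

Lemma real_analytic_immersive (R : realType) (D : set R) (f : R -> R) x : open D ->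
  real_analytic D f -> (forall x, D x -> derive1 f x != 0) -> D x -> immersive_near f x.
Proof.
move=> oD fD f0 Dx; have : nbhs x D by exact: open_nbhs_nbhs.
move=> Dn; rewrite /immersive_near; apply: filterS Dn => y Dy.
have f1 := real_analytic_derive1 fD; have f2 := real_analytic_derive1 f1.
by split; [exact: real_analytic_derivable Dy..|exact: f0].
Qed.

Section Perturbation.
Variables (R : realType) (D : set R) (phi : R -> R) (a Lam t : R) (m : nat).

(* [phase] is u_i and [perturb] is h_i \o phi_i for k = m.+2: the constants are
   chosen to make [perturb' = phi' * dgain] with [dgain = h_i' \o phi_i]. *)
Definition pscale : R := derive1 phi a * Lam.
Definition phase (x : R) : R := 1 - (phi x - phi a) / pscale.
Definition perturb (x : R) : R :=
  phi x - pscale * t / (m.+2%:R * m.+3%:R) * phase x ^+ m.+3.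

Definition phase' (x : R) : R := - derive1 phi x / pscale.
Definition phase'' (x : R) : R := - derive1 (derive1 phi) x / pscale.
Definition dgain (x : R) : R := 1 + t / m.+2%:R * phase x ^+ m.+2.
(** One differentiation uses up the factor [1 / m.+2]: where the phase lies in [0, 1], [dgain'] is
    of order [t] for every [m], and only [dgain''] can grow with [m]. *)
Definition dgain' (x : R) : R := t * (phase x ^+ m.+1 * phase' x).
Definition dgain'' (x : R) : R :=
  t * (m.+1%:R * phase x ^+ m * phase' x ^+ 2 + phase x ^+ m.+1 * phase'' x).

Hypotheses (D_open : open D) (phiD : real_analytic D phi)
  (phi'_neq0 : forall x, D x -> derive1 phi x != 0) (Da : D a)
  (Lam_gt0 : 0 < Lam) (t_gt0 : 0 < t) (m_even : ~~ odd m).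

Let p_neq0 : pscale != 0.
Proof. by rewrite mulf_neq0 ?phi'_neq0// gt_eqF. Qed.

Let d1 x : D x -> is_derive x 1 phi (derive1 phi x).
Proof. by move=> Dx; apply/derivable_is_derive/(real_analytic_derivable phiD). Qed.

Let d2 x : D x -> is_derive x 1 (derive1 phi) (derive1 (derive1 phi) x).
Proof.
move=> Dx; apply/derivable_is_derive/real_analytic_derivable/Dx.
exact: real_analytic_derive1.
Qed.

Lemma is_derive_phase x : D x -> is_derive x 1 phase (phase' x).
Proof.
move=> Dx.
rewrite (_ : phase = (fun y => (1 + phi a / pscale) + phi y * (- pscale^-1))); last first.
  by apply/funext => y; rewrite /phase; ring.
refine (is_derive_eq (is_derive_fun_add (is_derive_fun_cst (1 + phi a / pscale) x)
  (is_derive_fun_mul (d1 Dx) (is_derive_fun_cst (- pscale^-1) x))) _).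
by rewrite /phase'; ring.
Qed.

Lemma is_derive_phase' x : D x -> is_derive x 1 phase' (phase'' x).
Proof.
move=> Dx.
rewrite (_ : phase' = (fun y => derive1 phi y * (- pscale^-1))); last first.
  by apply/funext => y; rewrite /phase'; ring.
refine (is_derive_eq (is_derive_fun_mul (d2 Dx) (is_derive_fun_cst (- pscale^-1) x)) _).
by rewrite /phase''; ring.
Qed.

Lemma is_derive_dgain x : D x -> is_derive x 1 dgain (dgain' x).
Proof.
move=> Dx; refine (is_derive_eq (is_derive_fun_add (is_derive_fun_cst 1 x)
  (is_derive_fun_mul (is_derive_fun_cst (t / m.+2%:R) x)
  (is_derive_fun_exp m.+1 (is_derive_phase Dx)))) _).
by rewrite /dgain'; field; rewrite -(natrD _ 2) pnatr_eq0.
Qed.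

Lemma is_derive_dgain' x : D x -> is_derive x 1 dgain' (dgain'' x).
Proof.
move=> Dx; refine (is_derive_eq (is_derive_fun_mul (is_derive_fun_cst t x)
  (is_derive_fun_mul (is_derive_fun_exp m (is_derive_phase Dx)) (is_derive_phase' Dx))) _).
by rewrite /dgain''; ring.
Qed.

Lemma derive1_perturb x : D x -> derive1 perturb x = derive1 phi x * dgain x.
Proof.
move=> Dx; apply: is_derive_derive1.
rewrite (_ : perturb = (fun y => phi y +
    (- (pscale * t / (m.+2%:R * m.+3%:R))) * phase y ^+ m.+3)); last first.
  by apply/funext => y; rewrite mulNr.
refine (is_derive_eq (is_derive_fun_add (d1 Dx)
  (is_derive_fun_mul (is_derive_fun_cst (- (pscale * t / (m.+2%:R * m.+3%:R))) x)
  (is_derive_fun_exp m.+2 (is_derive_phase Dx)))) _).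
rewrite /dgain /phase'; move: (phase x) p_neq0 => u p0; field.
by rewrite p0 -(natrD _ 2) -(natrD _ 3) !pnatr_eq0.
Qed.

Lemma derive2_perturb x : D x -> derive1 (derive1 perturb) x =
  derive1 (derive1 phi) x * dgain x + derive1 phi x * dgain' x.
Proof.
move=> Dx; rewrite (derive1_open D_open derive1_perturb Dx).
by apply: is_derive_derive1; apply: is_derive_fun_mul; [exact: d2|exact: is_derive_dgain].
Qed.

Lemma dgain_ge1 x : 1 <= dgain x.
Proof.
rewrite lerDl mulr_ge0//; first by rewrite divr_ge0// ltW.
by rewrite exprn_even_ge0//= negbK.
Qed.

Lemma perturb_analytic : real_analytic D perturb.
Proof.
apply: real_analyticD => //.
rewrite (_ : (fun _ => _) = (fun x => - (pscale * t / (m.+2%:R * m.+3%:R)) *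
   ((1 + phi a / pscale) + phi x * (- pscale^-1)) ^+ m.+3)); last first.
  by apply/funext => x; rewrite mulNr; congr (- (_ * _ ^+ _)); rewrite /phase; ring.
apply: real_analyticM; first exact: real_analytic_cst.
apply: real_analyticX; apply: real_analyticD; first exact: real_analytic_cst.
by apply: real_analyticM => //; exact: real_analytic_cst.
Qed.

Lemma derive1_perturb_neq0 x : D x -> derive1 perturb x != 0.
Proof.
move=> Dx; rewrite derive1_perturb// mulf_neq0 ?phi'_neq0//.
by rewrite gt_eqF// (lt_le_trans ltr01)// dgain_ge1.
Qed.

(** T is the logarithmic derivative of the derivative, and [dgain] multiplies the derivative, so it
    adds its own logarithmic derivative. *)
Lemma preschwarzian_perturb x : D x ->
  preschwarzian perturb x = preschwarzian phi x + dgain' x / dgain x.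
Proof.
move=> Dx; rewrite /preschwarzian /= derive2_perturb// derive1_perturb//.
have alg (f1 f2 h h' : R) : f1 != 0 -> h != 0 ->
    (f2 * h + f1 * h') / (f1 * h) = f2 / f1 + h' / h.
  by move=> ? ?; field; apply/andP.
apply: alg; first exact: phi'_neq0.
by rewrite gt_eqF// (lt_le_trans ltr01)// dgain_ge1.
Qed.

Lemma derive1_preschwarzian_perturb x : D x -> derive1 (preschwarzian perturb) x =
  derive1 (preschwarzian phi) x +
  (dgain'' x / dgain x - (dgain' x / dgain x) ^+ 2).
Proof.
move=> Dx; rewrite (derive1_open D_open preschwarzian_perturb Dx).
have h0 : dgain x != 0 by rewrite gt_eqF// (lt_le_trans ltr01)// dgain_ge1.
apply: is_derive_derive1; refine (is_derive_eq (is_derive_fun_add _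
  (is_derive_fun_div h0 (is_derive_dgain' Dx) (is_derive_dgain Dx))) _); last first.
  congr (_ + _); move: (dgain'' x) (dgain' x) (dgain x) h0 => h2 h1 h h0.
  by field.
by apply: is_derive_preschwarzian; exact: (real_analytic_immersive D_open).
Qed.

End Perturbation.

(** * Monotonicity of the phase and bounds for the unperturbed data *)

Section PerturbationBounds.
Variables (R : realType) (D : set R) (phi : R -> R) (a b Lam : R).
Hypotheses (D_open : open D) (phiD : real_analytic D phi)
  (phi'_neq0 : forall x, D x -> derive1 phi x != 0)
  (ab : a < b) (abD : forall x, a <= x <= b -> D x) (Lam_gt0 : 0 < Lam).

Let Da : D a. Proof. by apply: abD; rewrite lexx ltW. Qed.

Let phi'a0 : derive1 phi a != 0. Proof. exact: phi'_neq0. Qed.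

Let cphi' x : a <= x <= b -> derive1 phi y @[y --> x] --> derive1 phi x.
Proof.
move=> /abD Dx; apply: is_derive_cvg (derivable_is_derive _).
exact: (real_analytic_derivable (real_analytic_derive1 phiD)).
Qed.

(** A sign change would force a zero of [phi'] by the intermediate value theorem. Normalising by the
    derivative at [a] makes [phase] decreasing for increasing and for decreasing [phi] alike. *)
Lemma derive1_same_sign x : a <= x <= b -> 0 < derive1 phi x / derive1 phi a.
Proof.
move=> /andP[ax xb]; rewrite ltNge; apply/negP => le0.
have cg : {within `[a, x], continuous (fun y => derive1 phi y / derive1 phi a)}.
  apply: continuous_in_subspaceT => y; rewrite inE/= in_itv/= => /andP[ay yx].
  by apply: cvgM; [apply: cphi'; rewrite ay (le_trans yx)|exact: cvg_cst].
have v0 : Num.min (derive1 phi a / derive1 phi a) (derive1 phi x / derive1 phi a) <= 0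
    <= Num.max (derive1 phi a / derive1 phi a) (derive1 phi x / derive1 phi a).
  by rewrite divff// ge_min le_max le0 ler01 orbT.
have [c cax] := IVT ax cg v0.
move/eqP; rewrite mulf_eq0 invr_eq0 (negbTE phi'a0) orbF; apply/negP/phi'_neq0/abD.
by move: cax; rewrite in_itv/= => /andP[-> cx]; rewrite (le_trans cx).
Qed.

Lemma phase_a : phase phi a Lam a = 1.
Proof. by rewrite /phase subrr mul0r subr0. Qed.

Lemma phase'_a : phase' phi a Lam a = - Lam^-1.
Proof. by rewrite /phase' /pscale invfM mulNr mulrA divff// mul1r. Qed.

Lemma phase'_lt0 x : a <= x <= b -> phase' phi a Lam x < 0.
Proof.
move=> xab; rewrite /phase' /pscale invfM mulrA mulNr mulNr oppr_lt0.
by rewrite divr_gt0// derive1_same_sign.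
Qed.

Lemma phase_lt x y : a <= x -> x < y -> y <= b -> phase phi a Lam y < phase phi a Lam x.
Proof.
move=> ax xy yb.
have dp z : z \in `[x, y] -> is_derive z 1 (phase phi a Lam) (phase' phi a Lam z).
  rewrite in_itv/= => /andP[xz zy]; apply: (is_derive_phase a Lam phiD).
  by apply: abD; rewrite (le_trans ax)//= (le_trans zy).
have dpo z : z \in `]x, y[ -> is_derive z 1 (phase phi a Lam) (phase' phi a Lam z).
  by move=> zoo; apply: dp; exact: subset_itv_oo_cc zoo.
have cp : {within `[x, y], continuous (phase phi a Lam)}.
  by apply: derivable_within_continuous => z /dp; exact: is_derive_derivable.
have [z zxy e] := MVT xy dpo cp.
rewrite -subr_lt0 e nmulr_rlt0 ?subr_gt0// phase'_lt0//.
move: zxy; rewrite in_itv/= => /andP[xz zy].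
by rewrite (le_trans ax (ltW xz)) (le_trans (ltW zy)).
Qed.

Lemma phase_le x y : a <= x -> x <= y -> y <= b -> phase phi a Lam y <= phase phi a Lam x.
Proof.
by move=> ax; rewrite le_eqVlt => /predU1P[->//|xy] yb; exact/ltW/phase_lt.
Qed.

Hypothesis Lam_ge : (phi b - phi a) / derive1 phi a <= Lam.

(** [Lam_ge] says exactly that the phase is still nonnegative at [b]; monotonicity gives the
    rest. *)
Lemma phase_itv x : a <= x <= b -> 0 <= phase phi a Lam x <= 1.
Proof.
move=> /andP[ax xb]; have := phase_le (lexx a) ax xb; rewrite phase_a => ->; rewrite andbT.
apply: le_trans (phase_le ax xb (lexx b)).
by rewrite /phase /pscale invfM mulrA subr_ge0 ler_pdivrMr// mul1r.
Qed.

Lemma phase_lt1 x : a < x <= b -> phase phi a Lam x < 1.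
Proof. by move=> /andP[ax xb]; rewrite -phase_a phase_lt. Qed.

(** Everything bounded here is continuous on the segment and depends on [phi], [a] and [Lam] only,
    so [C] is available before [t] and [m] are chosen. *)
Lemma profile_bound_exists : exists2 C : R, 0 <= C & forall x, a <= x <= b ->
  [/\ `|derive1 phi x| <= C, `|derive1 (derive1 phi) x| <= C,
      `|phase' phi a Lam x| <= C & `|phase'' phi a Lam x| <= C] /\
  [/\ `|preschwarzian phi x| <= C, `|derive1 (preschwarzian phi) x| <= C &
      `|pscale phi a Lam| <= C].
Proof.
pose phi1 := derive1 phi; pose phi2 := derive1 phi1; pose phi3 := derive1 phi2.
have a1 : real_analytic D phi1 by exact: real_analytic_derive1.
have a2 : real_analytic D phi2 by exact: real_analytic_derive1.
have a3 : real_analytic D phi3 by exact: real_analytic_derive1.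
have d1 x : D x -> is_derive x 1 phi1 (phi2 x).
  by move=> Dx; apply/derivable_is_derive/(real_analytic_derivable a1).
have d2 x : D x -> is_derive x 1 phi2 (phi3 x).
  by move=> Dx; apply/derivable_is_derive/(real_analytic_derivable a2).
have d3 x : D x -> is_derive x 1 phi3 (derive1 phi3 x).
  by move=> Dx; apply/derivable_is_derive/(real_analytic_derivable a3).
have bnd (f : R -> R) : (forall x, D x -> derivable f x 1) ->
    exists2 M : R, 0 <= M & forall x, a <= x <= b -> `|f x| <= M.
  move=> df; apply: continuous_bounded_segment (ltW ab) _ => x /abD Dx.
  exact: is_derive_cvg (derivable_is_derive (df x Dx)).
have [C1 C10 h1] := bnd phi1 (fun x Dx => is_derive_derivable (d1 x Dx)).
have [C2 C20 h2] := bnd phi2 (fun x Dx => is_derive_derivable (d2 x Dx)).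
have [C3 C30 h3] := bnd (phase' phi a Lam)
  (fun x Dx => is_derive_derivable (is_derive_phase' a Lam phiD Dx)).
have d2' x : D x -> is_derive x 1 (phase'' phi a Lam)
    (phi3 x * (- (pscale phi a Lam)^-1) + phi2 x * 0).
  move=> Dx; rewrite (_ : phase'' phi a Lam = (fun y => phi2 y * (- (pscale phi a Lam)^-1))).
    exact: (is_derive_fun_mul (d2 x Dx) (is_derive_fun_cst _ x)).
  by apply/funext => y; rewrite /phase'' mulrN mulNr.
have [C4 C40 h4] := bnd (phase'' phi a Lam) (fun x Dx => is_derive_derivable (d2' x Dx)).
have dT x : D x -> is_derive x 1 (preschwarzian phi) ((phi3 x * phi1 x - phi2 x * phi2 x) / phi1 x ^+ 2).
  by move=> Dx; exact: (is_derive_fun_div (phi'_neq0 Dx) (d2 x Dx) (d1 x Dx)).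
have [C5 C50 h5] := bnd (preschwarzian phi) (fun x Dx => is_derive_derivable (dT x Dx)).
have dG x : D x -> derivable (fun x => (phi3 x * phi1 x - phi2 x * phi2 x) / phi1 x ^+ 2) x 1.
  move=> Dx; have n0 : phi1 x ^+ 2 != 0 by exact/expf_neq0/phi'_neq0.
  exact: (is_derive_derivable (@is_derive_fun_div _ _ (fun y => phi1 y ^+ 2) _ _ _ n0
    (is_derive_fun_add (is_derive_fun_mul (d3 x Dx) (d1 x Dx))
      (is_deriveN (is_derive_fun_mul (d2 x Dx) (d2 x Dx))))
    (is_derive_fun_exp 1%N (d1 x Dx)))).
have [C6 C60 h6] := bnd _ dG.
pose C7 := `|pscale phi a Lam|; have C70 : 0 <= C7 by exact: normr_ge0.
pose C := C1 + C2 + C3 + C4 + C5 + C6 + C7.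
exists C; first by rewrite !addr_ge0.
move=> x xab; have Dx := abD xab.
have h6' : `|derive1 (preschwarzian phi) x| <= C6.
  by rewrite (is_derive_derive1 (dT x Dx)); exact: h6.
move: (h1 x xab) (h2 x xab) (h3 x xab) (h4 x xab) (h5 x xab) h6' => k1 k2 k3 k4 k5 k6.
have k7 : `|pscale phi a Lam| <= C7 by [].
have : [/\ C1 <= C, C2 <= C, C3 <= C & C4 <= C] /\ [/\ C5 <= C, C6 <= C & C7 <= C].
  rewrite /C; clear -C10 C20 C30 C40 C50 C60 C70; move: C7 C70 => c7 c70.
  by split; split; lra.
move=> [[l1 l2 l3 l4] [l5 l6 l7]].
by split; split; [apply: le_trans k1 l1|apply: le_trans k2 l2|apply: le_trans k3 l3
  |apply: le_trans k4 l4|apply: le_trans k5 l5|apply: le_trans k6 l6|apply: le_trans k7 l7].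
Qed.

End PerturbationBounds.

Lemma norm_div_ge1 (R : realType) (y h : R) : 1 <= h -> `|y / h| <= `|y|.
Proof.
move=> h1; have h0 : 0 < h by exact: lt_le_trans h1.
by rewrite normrM normfV (gtr0_norm h0) ler_pdivrMr// ler_peMr.
Qed.

Lemma norm_combine (R : realType) (T X Y Z B L C : R) : `|T| <= C -> `|X| <= L + C ->
  0 <= Y <= B -> 0 <= Z <= 4 * B -> `|T + X - Y - 2^-1 * Z| <= L + 2 * C + 3 * B.
Proof.
rewrite !ler_norml => /andP[? ?] /andP[? ?] /andP[? ?] /andP[? ?].
by apply/andP; split; lra.
Qed.

(** * Size of the perturbation, near the left endpoint and away from it *)

Section PerturbationEstimates.
Variables (R : realType) (D : set R) (phi : R -> R) (a b Lam t C : R) (m : nat).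
Hypotheses (D_open : open D) (phiD : real_analytic D phi)
  (phi'_neq0 : forall x, D x -> derive1 phi x != 0)
  (ab : a < b) (abD : forall x, a <= x <= b -> D x) (Lam_gt0 : 0 < Lam)
  (Lam_ge : (phi b - phi a) / derive1 phi a <= Lam)
  (t_gt0 : 0 < t) (t_le1 : t <= 1) (m_even : ~~ odd m) (C_ge0 : 0 <= C).
Hypothesis C_bound : forall x, a <= x <= b ->
  [/\ `|derive1 phi x| <= C, `|derive1 (derive1 phi) x| <= C,
      `|phase' phi a Lam x| <= C & `|phase'' phi a Lam x| <= C] /\
  [/\ `|preschwarzian phi x| <= C, `|derive1 (preschwarzian phi) x| <= C &
      `|pscale phi a Lam| <= C].

Local Notation u := (phase phi a Lam).
Local Notation psi := (perturb phi a Lam t m).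
Local Notation h := (dgain phi a Lam t m).
Local Notation h' := (dgain' phi a Lam t m).
Local Notation h'' := (dgain'' phi a Lam t m).

Let Da : D a. Proof. by apply: abD; rewrite lexx ltW. Qed.
Let aab : a <= a <= b. Proof. by rewrite lexx ltW. Qed.
Let u01 x : a <= x <= b -> 0 <= u x <= 1.
Proof. exact: (phase_itv phiD phi'_neq0 ab abD Lam_gt0 Lam_ge). Qed.
Let h1 x : 1 <= h x. Proof. exact: dgain_ge1. Qed.

Lemma dgain_le x : a <= x <= b -> h x <= 1 + t.
Proof.
move=> /u01/andP[u0 u1]; rewrite lerD2l -[leRHS]mulr1 ler_pM//.
- by rewrite divr_ge0// ltW.
- by rewrite exprn_ge0.
- by rewrite ler_pdivrMr// ler_peMr ?(ltW t_gt0) ?ler1n//.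
- by rewrite exprn_ile1.
Qed.

(** The power of the phase is kept rather than bounded by 1: away from [a] it makes the change of T
    negligible for large [m]. *)
Lemma dgain'_le x : a <= x <= b -> `|h' x| <= t * (C * u x ^+ m.+1).
Proof.
move=> xab; have [[_ _ c _] _] := C_bound xab; have /andP[u0 u1] := u01 xab.
rewrite /dgain' normrM (gtr0_norm t_gt0) ler_pM2l// mulrC normrM.
by rewrite (ger0_norm (exprn_ge0 _ u0)) ler_wpM2r// exprn_ge0.
Qed.

Lemma dgain'_leC x : a <= x <= b -> `|h' x| <= t * C.
Proof.
move=> xab; rewrite (le_trans (dgain'_le xab))// ler_pM2l//.
by have /andP[u0 u1] := u01 xab; rewrite ler_piMr// exprn_ile1.
Qed.

Lemma dgain''_le x : a <= x <= b ->
  `|h'' x| <= t * (m.+1%:R * u x ^+ m * C ^+ 2 + C).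
Proof.
move=> xab; have [[_ _ c1 c2] _] := C_bound xab; have /andP[u0 u1] := u01 xab.
rewrite /dgain'' normrM (gtr0_norm t_gt0) ler_pM2l//.
rewrite (le_trans (ler_normD _ _))// lerD//.
  have v0 : 0 <= m.+1%:R * u x ^+ m by rewrite mulr_ge0// exprn_ge0.
  by rewrite normrM (ger0_norm v0) ler_wpM2l// normrX lerXn2r// ?nnegrE// normr_ge0.
rewrite normrM (ger0_norm (exprn_ge0 _ u0)) -[leRHS]mul1r ler_pM// ?exprn_ge0//.
by rewrite exprn_ile1.
Qed.

Lemma perturb_dist x : a <= x <= b -> `|psi x - phi x| <= C * t.
Proof.
move=> xab; have [_ [_ _ c]] := C_bound xab; have /andP[u0 u1] := u01 xab.
rewrite /perturb addrAC subrr add0r normrN.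
rewrite -(mulrA (pscale _ _ _)) -(mulrA (pscale _ _ _)) normrM ler_pM//.
have k0 : 0 < m.+2%:R * m.+3%:R :> R by rewrite mulr_gt0.
rewrite ger0_norm; last by rewrite mulr_ge0 ?exprn_ge0// divr_ge0// ltW.
rewrite -[leRHS]mulr1 ler_pM ?exprn_ge0 ?exprn_ile1//; first by rewrite divr_ge0// ltW.
by rewrite ler_pdivrMr// ler_peMr ?(ltW t_gt0)// -natrM ler1n.
Qed.

Lemma derive1_perturb_dist x : a <= x <= b ->
  `|derive1 psi x - derive1 phi x| <= C * t.
Proof.
move=> xab; have [[c _ _ _] _] := C_bound xab; have := dgain_le xab; have := h1 x.
rewrite (derive1_perturb t m phiD phi'_neq0 Da Lam_gt0 (abD xab)).
rewrite -{2}(mulr1 (derive1 phi x)) -mulrBr normrM => k1 kt; rewrite ler_pM//.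
by rewrite ger0_norm ?subr_ge0// lerBlDl.
Qed.

Lemma derive2_perturb_dist x : a <= x <= b ->
  `|derive1 (derive1 psi) x - derive1 (derive1 phi) x| <= (C + C ^+ 2) * t.
Proof.
move=> xab; have [[c1 c2 _ _] _] := C_bound xab; have := dgain_le xab; have := h1 x.
have := dgain'_leC xab.
rewrite (derive2_perturb t m D_open phiD phi'_neq0 Da Lam_gt0 (abD xab)) => ht k1 kt.
rewrite addrAC -{2}(mulr1 (derive1 (derive1 phi) x)) -mulrBr mulrDl.
rewrite (le_trans (ler_normD _ _))// lerD// normrM.
  by rewrite ler_pM// ger0_norm ?subr_ge0// lerBlDl.
by rewrite expr2 -mulrA ler_pM// mulrC.
Qed.

Lemma preschwarzian_perturb_dist x : a <= x <= b ->
  `|preschwarzian psi x - preschwarzian phi x| <= C * u x ^+ m.+1.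
Proof.
move=> xab; have Dx := abD xab.
rewrite (preschwarzian_perturb D_open phiD phi'_neq0 Da Lam_gt0 t_gt0 m_even Dx).
rewrite [X in `|X|](_ : _ = h' x / h x); last by rewrite addrC addKr.
rewrite (le_trans (norm_div_ge1 _ (h1 x)))// (le_trans (dgain'_le xab))//.
rewrite -[leRHS]mul1r ler_wpM2r// mulr_ge0// exprn_ge0//.
by case/andP: (u01 xab).
Qed.

Lemma preschwarzian_perturb_le x : a <= x <= b -> `|preschwarzian psi x| <= 2 * C.
Proof.
move=> xab; have [_ [c _ _]] := C_bound xab; have /andP[u0 u1] := u01 xab.
rewrite -(subrK (preschwarzian phi x) (preschwarzian psi x)).
rewrite (le_trans (ler_normD _ _))// mulrDl mul1r lerD//.
by rewrite (le_trans (preschwarzian_perturb_dist xab))// ler_piMr// exprn_ile1.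
Qed.

Lemma derive1_preschwarzian_perturb_le x : a <= x <= b ->
  `|derive1 (preschwarzian psi) x| <= C + (m.+1%:R * u x ^+ m * C ^+ 2 + C) + C ^+ 2.
Proof.
move=> xab; have Dx := abD xab; have [_ [_ c _]] := C_bound xab.
have /andP[u0 u1] := u01 xab.
rewrite (derive1_preschwarzian_perturb D_open phiD phi'_neq0 Da Lam_gt0 t_gt0 m_even Dx).
rewrite -addrA (le_trans (ler_normD _ _))// lerD//.
rewrite (le_trans (ler_normB _ _))// lerD//.
  rewrite (le_trans (norm_div_ge1 _ (h1 x)))// (le_trans (dgain''_le xab))//.
  rewrite -[leRHS]mul1r ler_wpM2r// addr_ge0// !mulr_ge0// exprn_ge0//.
rewrite normrX lerXn2r// ?nnegrE ?normr_ge0//.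
rewrite (le_trans (norm_div_ge1 _ (h1 x)))// (le_trans (dgain'_leC xab))//.
by rewrite -[leRHS]mul1r ler_wpM2r.
Qed.

Lemma schwarzian_perturb_le x : a <= x <= b -> `|schwarzian psi x| <=
  C + (m.+1%:R * u x ^+ m * C ^+ 2 + C) + C ^+ 2 + 2 * C ^+ 2.
Proof.
move=> xab; rewrite /schwarzian (le_trans (ler_normB _ _))// lerD//.
  exact: derive1_preschwarzian_perturb_le.
rewrite normrM normrX.
have -> : 2 * C ^+ 2 = `|2^-1| * (2 * C) ^+ 2.
  by rewrite ger0_norm; [field|rewrite invr_ge0].
by rewrite ler_wpM2l// lerXn2r// ?nnegrE ?normr_ge0 ?mulr_ge0// preschwarzian_perturb_le.
Qed.

(** At [a] the phase is 1 with slope -1/Lam, so the added term is -(t/Lam) / (1 + t/k) with k =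
    [m.+2]. The error comes from the denominator alone, hence is of order 1/k. *)
Lemma preschwarzian_perturb_left :
  `|preschwarzian psi a - preschwarzian phi a + t / Lam| <= (Lam * m.+2%:R)^-1.
Proof.
rewrite (preschwarzian_perturb D_open phiD phi'_neq0 Da Lam_gt0 t_gt0 m_even Da).
rewrite [X in `|X + _|](_ : _ = h' a / h a); last by rewrite addrC addKr.
rewrite /dgain' /dgain phase_a !expr1n (phase'_a Lam phi'_neq0 ab abD).
have k0 : 0 < m.+2%:R :> R by [].
move: (m.+2%:R : R) k0 => k k0.
have l0 : Lam != 0 by rewrite gt_eqF.
have kt0 : 0 < k + t by rewrite addr_gt0.
have -> : t * (1 * - Lam^-1) / (1 + t / k * 1) + t / Lam = t * t / (k + t) * Lam^-1.
  by field; rewrite l0 !gt_eqF//= ?divr_gt0// addr_gt0.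
rewrite ger0_norm; last by rewrite !mulr_ge0 ?invr_ge0// ltW.
rewrite invfM mulrC ler_pM2l ?invr_gt0// ler_pdivrMr//.
have -> : k^-1 * (k + t) = 1 + t / k by field; rewrite gt_eqF.
by rewrite (@le_trans _ _ 1)// ?mulr_ile1 ?(ltW t_gt0)// lerDl divr_ge0// ltW.
Qed.

(** Only [dgain''] grows with [m]. Dividing its main term t (k - 1) / Lam^2 by 1 + t/k, with k =
    [m.+2], is a relative change of order t/k, hence a bounded absolute one. *)
Lemma schwarzian_perturb_left :
  `|schwarzian psi a - t * m.+1%:R / Lam ^+ 2| <= (Lam ^+ 2)^-1 + 2 * C + 3 * C ^+ 2.
Proof.
have [[_ _ _ c4] [_ c6 _]] := C_bound aab.
rewrite /schwarzian (derive1_preschwarzian_perturb D_open phiD phi'_neq0 Da Lam_gt0 t_gt0 m_even Da).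
have p1 := dgain'_leC aab; have p2 := preschwarzian_perturb_le aab.
have h'a := le_trans (norm_div_ge1 _ (h1 a)) p1.
have : `|h'' a / h a - t * m.+1%:R / Lam ^+ 2| <= (Lam ^+ 2)^-1 + C.
  rewrite /dgain'' /dgain phase_a !expr1n (phase'_a Lam phi'_neq0 ab abD).
  move: (phase'' phi a Lam a) c4 => w c4.
  pose k : R := m.+2%:R; have k0 : 0 < k by [].
  have kt0 : 0 < k + t by rewrite addr_gt0.
  have l0 : Lam != 0 by rewrite gt_eqF.
  rewrite -/k (_ : m.+1%:R = k - 1); last by rewrite /k -[m.+2]addn1 natrD addrK.
  rewrite [X in `|X|](_ : _ = t * w / (1 + t / k) - t * t * (k - 1) / (k + t) / Lam ^+ 2);
    last by field; rewrite l0 !gt_eqF//= ?divr_gt0// addr_gt0.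
  rewrite (le_trans (ler_normB _ _))// addrC lerD//; last first.
    have kt1 : 1 <= 1 + t / k by rewrite lerDl divr_ge0// ltW.
    rewrite (le_trans (norm_div_ge1 _ kt1))// normrM (gtr0_norm t_gt0).
    by rewrite -[leRHS]mul1r ler_pM// ltW.
  have k1 : 0 <= k - 1 by rewrite /k -[m.+2]addn1 natrD addrK.
  rewrite ger0_norm; last by rewrite !mulr_ge0 ?invr_ge0 ?exprn_ge0// ltW.
  rewrite -[leRHS]mul1r ler_wpM2r ?invr_ge0 ?exprn_ge0 ?(ltW Lam_gt0)//.
  rewrite ler_pdivrMr// mul1r (@le_trans _ _ (1 * (k - 1)))//.
    by rewrite ler_wpM2r// mulr_ile1// ltW.
  by rewrite mul1r lerD2l (le_trans _ (ltW t_gt0))// lerN10.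
move: (h'' a / h a) (h' a / h a) h'a (preschwarzian psi a) p2 c6 => x y hy z hz hT hx.
rewrite [X in `|X|](_ : _ = derive1 (preschwarzian phi) a +
  (x - t * m.+1%:R / Lam ^+ 2) - y ^+ 2 - 2^-1 * z ^+ 2); last by ring.
have y2 : y ^+ 2 <= C ^+ 2.
  rewrite -real_normK ?num_real// lerXn2r ?nnegrE ?normr_ge0//.
  by rewrite (le_trans hy)// -[leRHS]mul1r ler_wpM2r.
have z2 : z ^+ 2 <= (2 * C) ^+ 2.
  by rewrite -real_normK ?num_real// lerXn2r ?nnegrE ?normr_ge0 ?mulr_ge0.
(* The bound 3 C^2 splits into C^2 for the squared logarithmic derivative of [dgain] and half of (2
   C)^2 for the square of T. *)
apply: norm_combine => //; first by rewrite sqr_ge0.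
by rewrite sqr_ge0 (le_trans z2)// exprMn -natrX.
Qed.

End PerturbationEstimates.

(** * The perturbed system *)

Section IFSEstimates.
Variables (R : realType) (N : nat) (Psi : IFS R N) (a b x1 rho : R).
Hypotheses (ax1 : a <= x1) (rho01 : 0 <= rho < 1)
  (Psi_immersive : forall i x, a <= x <= b -> immersive_near (Psi i) x)
  (Psi_itv : forall i x, a <= x <= b -> x1 <= Psi i x <= b)
  (Psi_contr : forall i x, a <= x <= b -> `|derive1 (Psi i) x| <= rho).

Let A := [set x : R | a <= x <= b].
Let X := [set x : R | x1 <= x <= b].

Let XA : X `<=` A.
Proof. by move=> x /andP[xx xb]; rewrite /A /= xb (le_trans ax1). Qed.

Let PsiAX i x : A x -> X (Psi i x). Proof. exact: Psi_itv. Qed.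
Let PsiA i x : A x -> A (Psi i x). Proof. by move=> Ax; exact/XA/PsiAX. Qed.
Let PsiX i x : X x -> X (Psi i x). Proof. by move=> Xx; exact/PsiAX/XA. Qed.

Let gT i x : A x -> `|derive1 (Psi i) x| <= rho. Proof. exact: Psi_contr. Qed.

Let gS i x : A x -> `|derive1 (Psi i) x ^+ 2| <= rho.
Proof.
move=> Ax; have /andP[r0 r1] := rho01; rewrite normrX.
apply: (@le_trans _ _ (rho ^+ 2)); first by rewrite lerXn2r// ?nnegrE// gT.
by rewrite expr2 ler_piMr// ltW.
Qed.

Let dPsi i x : A x -> [/\ is_derive x 1 (Psi i) (derive1 (Psi i) x),
  is_derive x 1 (derive1 (Psi i)) (derive1 (derive1 (Psi i)) x) &
  is_derive x 1 (preschwarzian (Psi i)) (derive1 (preschwarzian (Psi i)) x)].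
Proof.
move=> Ax; have im := Psi_immersive i Ax.
have [p1 p2 _ _] := nbhs_singleton im.
by split; [exact: derivable_is_derive|exact: derivable_is_derive|
  exact: is_derive_preschwarzian].
Qed.

Let T s := preschwarzian (fword Psi s).
Let S s := schwarzian (fword Psi s).

Let T_nil x : A x -> T [::] x = 0.
Proof. by move=> _; rewrite /T preschwarzian_fword_nil. Qed.

Let S_nil x : A x -> S [::] x = 0.
Proof. by move=> _; rewrite /S schwarzian_fword_nil. Qed.

Let T_cons i s x : A x ->
  T (i :: s) x = preschwarzian (Psi i) x + T s (Psi i x) * derive1 (Psi i) x.
Proof. exact: (preschwarzian_fword_cons PsiA Psi_immersive). Qed.

Let S_cons i s x : A x ->
  S (i :: s) x = schwarzian (Psi i) x + S s (Psi i x) * derive1 (Psi i) x ^+ 2.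
Proof. exact: (schwarzian_fword_cons PsiA Psi_immersive). Qed.

(** Both points enter [[x1, b]] after one step, so the tail needs a Lipschitz bound only there. The
    difference of the first letter itself is subtracted: it carries the jump to be detected, and
    near [a] it has no Lipschitz bound uniform in the exponent. *)
Lemma preschwarzian_fword_diff (B K x : R) i s : 0 <= B -> 0 <= K ->
  (forall i x, a <= x <= b -> `|preschwarzian (Psi i) x| <= B) ->
  (forall i x, a <= x <= b -> `|derive1 (derive1 (Psi i)) x| <= K) ->
  (forall i x, x1 <= x <= b -> `|derive1 (preschwarzian (Psi i)) x| <= K) ->
  a <= x <= b ->
  `|(T (i :: s) a - T (i :: s) x) - (preschwarzian (Psi i) a - preschwarzian (Psi i) x)| <=
  ((K + B / (1 - rho) * K) / (1 - rho) + B / (1 - rho) * K) * (x - a).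
Proof.
move=> B0 K0 TB dK TK Ax; have /andP[ax xb] := Ax; have /andP[r0 r1] := rho01.
have Aa : A a by rewrite /A /= lexx (le_trans ax).
pose M : R := B / (1 - rho).
have M0 : 0 <= M by rewrite divr_ge0// subr_ge0 ltW.
have TM t y : A y -> `|T t y| <= M.
  exact: (cocycle_bound rho01 T_nil T_cons gT (@subset_refl _ A) PsiA B0 TB).
pose L : R := (K + M * K) / (1 - rho).
have lipPsi i0 y z : A y -> A z -> `|Psi i0 y - Psi i0 z| <= `|y - z|.
  move=> Ay Az; rewrite -[leRHS]mul1r.
  apply: (mvt_lipschitz (fun w Aw => let: And3 h _ _ := dPsi i0 Aw in h) _ Ay Az).
  by move=> w Aw; rewrite (le_trans (gT i0 Aw))// ltW.
have lipg i0 y z : A y -> A z -> `|derive1 (Psi i0) y - derive1 (Psi i0) z| <= K * `|y - z|.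
  move=> Ay Az.
  exact: (mvt_lipschitz (fun w Aw => let: And3 _ h _ := dPsi i0 Aw in h) (dK i0) Ay Az).
have lipc i0 y z : X y -> X z ->
    `|preschwarzian (Psi i0) y - preschwarzian (Psi i0) z| <= K * `|y - z|.
  move=> Xy Xz.
  exact: (mvt_lipschitz (fun w Xw => let: And3 _ _ h := dPsi i0 (XA Xw) in h) (TK i0) Xy Xz).
have lipT t y z : X y -> X z -> `|T t y - T t z| <= L * `|y - z|.
  apply: (cocycle_lipschitz rho01 T_nil T_cons gT XA PsiX M0 K0) => //.
  - by move=> t' y' /XA; exact: TM.
  - by move=> i' y' z' /XA Ay /XA Az; exact: lipg.
  - by move=> i' y' z' /XA Ay /XA Az; exact: lipPsi.
have L0 : 0 <= L.
  by rewrite divr_ge0//; [rewrite addr_ge0// mulr_ge0|rewrite subr_ge0 ltW].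
rewrite !T_cons// [X in `|X|](_ : _ =
  (T s (Psi i a) - T s (Psi i x)) * derive1 (Psi i) a +
  T s (Psi i x) * (derive1 (Psi i) a - derive1 (Psi i) x)); last by ring.
have axE : `|a - x| = x - a by rewrite distrC ger0_norm// subr_ge0.
rewrite [leRHS]mulrDl -axE (le_trans (ler_normD _ _))// lerD// normrM.
  rewrite -[leRHS]mulr1 ler_pM//; last by rewrite (le_trans (gT i Aa))// ltW.
  by rewrite (le_trans (lipT _ _ _ (PsiAX i Aa) (PsiAX i Ax)))// ler_wpM2l// lipPsi.
rewrite -mulrA; apply: (ler_pM (normr_ge0 _) (normr_ge0 _) (TM _ _ (PsiA i Ax))).
exact: lipg.
Qed.

(** The tail is evaluated at [Psi i a] only, so a bound for the letters on [[x1, b]] suffices; at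
    [a] the Schwarzian of the letter is the large term to be detected. *)
Lemma schwarzian_fword_diff (B : R) i s : 0 <= B -> a <= b ->
  (forall i x, x1 <= x <= b -> `|schwarzian (Psi i) x| <= B) ->
  `|S (i :: s) a - schwarzian (Psi i) a| <= B / (1 - rho).
Proof.
move=> B0 ab SB; have /andP[r0 r1] := rho01.
have Aa : A a by rewrite /A /= lexx.
rewrite S_cons// addrC addKr normrM -[leRHS]mulr1 ler_pM//.
  exact: (cocycle_bound rho01 S_nil S_cons gS XA PsiX B0 SB _ (PsiAX i Aa)).
by rewrite (le_trans (gS i Aa))// ltW.
Qed.

Section Infimum.
Variable Omega : set R.
Hypotheses (N2 : (2 <= N)%N) (OmegaE : closure Omega = A).

Lemma inf_preschwarzian_gt0 (B kappa p q e : R) : 0 <= B ->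
  (forall i x, a <= x <= b -> `|preschwarzian (Psi i) x| <= B) ->
  a <= p <= b -> a <= q <= b -> `|kappa| <= 1 -> 0 < e ->
  (forall i j s t, i != j -> e <= `|(T (i :: s) p - T (j :: t) p)
     - kappa * (T (i :: s) q - T (j :: t) q)|) ->
  0 < inf [set supnorm (closure Omega)
     (Tword Omega Psi w.1 \- Tword Omega Psi w.2) | w in @Zpairs N].
Proof.
move=> B0 TB Ap Aq k1 e0 sep.
have TM t y : A y -> `|T t y| <= B / (1 - rho).
  exact: (cocycle_bound rho01 T_nil T_cons gT (@subset_refl _ A) PsiA B0 TB).
apply: (@inf_supnorm_gt0 _ _ _ _ _ rho (B / (1 - rho)) rho01 _ _ kappa p q e) => //.
- by rewrite OmegaE.
- by rewrite OmegaE; exact: (cocycle_prefix PsiA T_nil T_cons gT TM).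
- by rewrite OmegaE.
- by rewrite OmegaE.
Qed.

Lemma inf_schwarzian_gt0 (B p e : R) : 0 <= B ->
  (forall i x, a <= x <= b -> `|schwarzian (Psi i) x| <= B) ->
  a <= p <= b -> 0 < e ->
  (forall i j s t, i != j -> e <= `|S (i :: s) p - S (j :: t) p|) ->
  0 < inf [set supnorm (closure Omega)
     (Sword Omega Psi w.1 \- Sword Omega Psi w.2) | w in @Zpairs N].
Proof.
move=> B0 SB Ap e0 sep.
have SM t y : A y -> `|S t y| <= B / (1 - rho).
  exact: (cocycle_bound rho01 S_nil S_cons gS (@subset_refl _ A) PsiA B0 SB).
apply: (@inf_supnorm_gt0 _ _ _ _ _ rho (B / (1 - rho)) rho01 _ _ 0 p p e) => //.
- by rewrite OmegaE.
- by rewrite OmegaE; exact: (cocycle_prefix PsiA S_nil S_cons gS SM).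
- by rewrite OmegaE.
- by rewrite OmegaE.
- by rewrite normr0.
- by move=> i j s t ij; rewrite mul0r subr0; exact: sep.
Qed.

End Infimum.
End IFSEstimates.

(** * Uniform constants from finiteness and compactness *)

Section FiniteBounds.
Variables (R : realType) (N : nat) (P : 'I_N -> R -> Prop).

Lemma finite_upper_bound : (forall i M M', M <= M' -> P i M -> P i M') ->
  (forall i, exists2 M : R, 0 <= M & P i M) ->
  exists2 M : R, 0 <= M & forall i, P i M.
Proof.
move=> Pmono Pex.
have /choice[f fP] : forall i, exists M, 0 <= M /\ P i M.
  by move=> i; have [M M0 PM] := Pex i; exists M.
exists (\sum_i f i); first by apply: sumr_ge0 => i _; have [] := fP i.
move=> i; have [f0 Pf] := fP i; apply: Pmono Pf.
by rewrite (bigD1 i)//= lerDl sumr_ge0// => j _; have [] := fP j.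
Qed.

End FiniteBounds.

Lemma finite_lower_bound (R : realType) (N : nat) (P : 'I_N -> R -> Prop) :
  (forall i d d', d' <= d -> P i d -> P i d') ->
  (forall i, exists2 d : R, 0 < d & P i d) ->
  exists2 d : R, 0 < d & forall i, P i d.
Proof.
move=> Pmono Pex.
(* Small constants are traded for large ones through [(1 + M)^-1], which is positive even for
   [M = 0]. *)
have [M M0 PM] : exists2 M : R, 0 <= M & forall i, 0 <= M /\ P i (1 + M)^-1.
  apply: (@finite_upper_bound _ _ (fun i M => 0 <= M /\ P i (1 + M)^-1)).
    move=> i M M' MM' [M0 PM]; have M'0 := le_trans M0 MM'; split => //.
    apply: Pmono PM; rewrite lef_pV2 ?lerD2l// posrE ltr_pwDl//.
  move=> i; have [d d0 Pd] := Pex i; exists d^-1; first by rewrite invr_ge0 ltW.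
  split; first by rewrite invr_ge0 ltW.
  apply: Pmono Pd; rewrite -[leRHS]invrK lef_pV2 ?lerDr// posrE ?invr_gt0//.
  by rewrite ltr_pwDl// invr_ge0 ltW.
exists (1 + M)^-1; first by rewrite invr_gt0 ltr_pwDl.
by move=> i; have [] := PM i.
Qed.

Lemma closure_oo (R : realType) (a b : R) : a < b ->
  closure `]a, b[ = [set x : R | a <= x <= b].
Proof.
move=> ab; rewrite eqEsubset; split=> [x /itv_closure|x /= /andP[ax xb]].
  by rewrite /= in_itv.
move=> B /nbhs_ballP[e /= e0 eB].
(* Moving [x] towards the midpoint by the fraction [s] lands strictly inside, and the displacement
   is at most [s * (b - a) < e]. *)
pose s : R := e / (e + (b - a)).
have d0 : 0 < b - a by rewrite subr_gt0.
have s0 : 0 < s by rewrite divr_gt0// addr_gt0.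
have ed0 : 0 < e + (b - a) by exact: addr_gt0.
have s1 : s < 1 by rewrite /s ltr_pdivrMr// mul1r ltrDl.
have sE : s * (b - a) < e.
  by rewrite /s mulrAC ltr_pdivrMr// ltr_pM2l// ltrDr.
pose y : R := x + s * ((a + b) / 2 - x).
have yE : y = (1 - s) * x + s * ((a + b) / 2) by rewrite /y; ring.
have yab : a < y < b.
  have m1 : 0 < s * ((a + b) / 2 - a) by rewrite mulr_gt0//; lra.
  have m2 : 0 < s * (b - (a + b) / 2) by rewrite mulr_gt0//; lra.
  have m3 : 0 <= (1 - s) * (x - a) by rewrite mulr_ge0// subr_ge0// ltW.
  have m4 : 0 <= (1 - s) * (b - x) by rewrite mulr_ge0// subr_ge0// ltW.
  by apply/andP; split; rewrite yE; lra.
exists y; split; first by rewrite /= in_itv.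
apply: eB; rewrite /ball /= /y opprD addNKr normrN normrM (gtr0_norm s0).
apply: le_lt_trans sE; rewrite ler_pM2l// ler_norml.
by apply/andP; split; lra.
Qed.

(** The extrema are attained on the segment, so strict inequalities leave room. The room is written
    [2 * d] so that a perturbation of size [d] still leaves [d]. *)
Lemma contraction_margin (R : realType) (phi : R -> R) (a b : R) : a < b ->
  (forall x, a <= x <= b -> derivable phi x 1) ->
  (forall x, a <= x <= b -> derivable (derive1 phi) x 1) ->
  (forall x, a <= x <= b -> a < phi x < b) ->
  (forall x, a <= x <= b -> `|derive1 phi x| < 1) ->
  exists2 d : R, 0 < d & forall x, a <= x <= b ->
    [/\ a + 2 * d <= phi x, phi x <= b - 2 * d & `|derive1 phi x| <= 1 - 2 * d].
Proof.
move=> ab d1 d2 pab p1.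
have cphi : {within `[a, b], continuous phi}.
  by apply: derivable_within_continuous => x; rewrite in_itv/=; exact: d1.
have cphi' : {within `[a, b], continuous (fun x => `|derive1 phi x|)}.
  apply: continuous_in_subspaceT => x; rewrite inE/= in_itv/= => xab.
  by apply: cvg_norm; exact: is_derive_cvg (derivable_is_derive (d2 x xab)).
have [u uab hu] := EVT_max (ltW ab) cphi; have [v vab hv] := EVT_min (ltW ab) cphi.
have [w wab hw] := EVT_max (ltW ab) cphi'.
rewrite !in_itv/= in uab vab wab.
have /andP[_ ub] := pab _ uab; have /andP[va _] := pab _ vab; have w1 := p1 _ wab.
pose d : R := Num.min (Num.min (phi v - a) (b - phi u)) (1 - `|derive1 phi w|) / 2.
have d0 : 0 < d by rewrite divr_gt0// !lt_min !subr_gt0 va ub.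
have h2 : 2 * d = Num.min (Num.min (phi v - a) (b - phi u)) (1 - `|derive1 phi w|).
  by rewrite /d; field.
have [dv [du dw]] : 2 * d <= phi v - a /\ (2 * d <= b - phi u /\ 2 * d <= 1 - `|derive1 phi w|).
  by rewrite h2 !ge_min !lexx !orbT.
exists d => // x xab; have xI : x \in `[a, b] by rewrite in_itv.
have := hu x xI; have := hv x xI; have := hw x xI => hw' hv' hu'; split.
- by rewrite -lerBrDl (le_trans dv)// lerD2r.
- by rewrite lerBrDl -lerBrDr (le_trans du)// lerD2l lerN2.
- by rewrite lerBrDl -lerBrDr (le_trans dw)// lerD2l lerN2.
Qed.

(** [A], [B], [C] stand for T of a word, of its perturbed first letter and of the unperturbed one,
    at [a] (index 1) and at [x] (index 2); [T] is the predicted jump. The budget is g/4 = g/16 +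
    g/16 + g/8. *)
Lemma norm_combine_jump (R : realType) (A1 A2 B1 B2 C1 C2 T v c g : R) :
  `|B1 - C1 + T| <= g / 16 -> `|B2 - C2| <= g / 16 -> `|A1 - A2 - (B1 - B2)| <= v ->
  `|C1 - C2| <= c -> c + v <= g / 8 -> `|A1 - A2 + T| <= g / 4.
Proof.
rewrite !ler_norml => /andP[? ?] /andP[? ?] /andP[? ?] /andP[? ?] ?.
by apply/andP; split; lra.
Qed.

Lemma norm_combine_separation (R : realType) (A1 A2 B1 B2 E e : R) :
  `|A1 - B1| <= E -> `|A2 - B2| <= E -> 2 * E + e <= `|B1 - B2| -> e <= `|A1 - A2|.
Proof.
move=> h1 h2 h; have := ler_distD A1 B1 B2; have := ler_distD A2 A1 B2.
by rewrite (distrC B1 A1); lra.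
Qed.

(** * The perturbed system: estimates uniform in the exponent, and separation *)

Section PerturbedIFS.
Variables (R : realType) (N : nat) (D : set R) (Phi : IFS R N) (a b : R).
Variables (Lam C delta beta Q : R) (m : nat).
Hypotheses (D_open : open D) (PhiD : forall i, real_analytic D (Phi i))
  (Phi'_neq0 : forall i x, D x -> derive1 (Phi i) x != 0)
  (ab : a < b) (abD : forall x, a <= x <= b -> D x).
Hypotheses (Lam_gt0 : 0 < Lam)
  (Lam_ge : forall i, (Phi i b - Phi i a) / derive1 (Phi i) a <= Lam)
  (C_ge0 : 0 <= C) (C_bound : forall i x, a <= x <= b ->
  [/\ `|derive1 (Phi i) x| <= C, `|derive1 (derive1 (Phi i)) x| <= C,
      `|phase' (Phi i) a Lam x| <= C & `|phase'' (Phi i) a Lam x| <= C] /\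
  [/\ `|preschwarzian (Phi i) x| <= C, `|derive1 (preschwarzian (Phi i)) x| <= C &
      `|pscale (Phi i) a Lam| <= C]).
Hypotheses (delta_gt0 : 0 < delta) (margin : forall i x, a <= x <= b ->
    [/\ a + 2 * delta <= Phi i x, Phi i x <= b - 2 * delta &
        `|derive1 (Phi i) x| <= 1 - 2 * delta]).
Hypotheses (beta_gt0 : 0 < beta) (betaN_le1 : beta * N%:R <= 1)
  (betaN_le : (C + C ^+ 2) * (beta * N%:R) <= delta).
Hypotheses (Q_ge0 : 0 <= Q) (Q_bound : forall i, (1 - phase (Phi i) a Lam (a + delta))^-1 <= Q).
Hypothesis m_even : ~~ odd m.

Definition amplitude (i : 'I_N) : R := beta * i.+1%:R.
Definition perturbed : IFS R N := fun i => perturb (Phi i) a Lam (amplitude i) m.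

Let t_gt0 i : 0 < amplitude i. Proof. by rewrite mulr_gt0. Qed.

Let t_leN i : amplitude i <= beta * N%:R.
Proof. by rewrite ler_pM2l// ler_nat. Qed.

Let t_le1 i : amplitude i <= 1. Proof. exact: le_trans betaN_le1. Qed.

Let Da : D a. Proof. by apply: abD; rewrite lexx ltW. Qed.

Let CC_ge0 : 0 <= C + C ^+ 2. Proof. by rewrite addr_ge0// sqr_ge0. Qed.

Let C_le : C <= C + C ^+ 2. Proof. by rewrite lerDl sqr_ge0. Qed.

Lemma amplitude_dist i j : i != j -> beta <= `|amplitude i - amplitude j|.
Proof.
wlog ij : i j / (i < j)%N.
  move=> W ij; have [lt|gt|e] := ltngtP i j; first exact: W.
    by rewrite distrC; apply: W => //; rewrite eq_sym.
  by move: ij; rewrite (val_inj e) eqxx.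
move=> _; rewrite distrC /amplitude -mulrBr normrM (gtr0_norm beta_gt0) ler_peMr ?(ltW beta_gt0)//.
by rewrite -natrB ?ltnS 1?ltnW// subSS normr_nat ler1n subn_gt0.
Qed.

Lemma perturbed_dist i x : a <= x <= b ->
  [/\ `|Phi i x - perturbed i x| <= (C + C ^+ 2) * (beta * N%:R),
      `|derive1 (Phi i) x - derive1 (perturbed i) x| <= (C + C ^+ 2) * (beta * N%:R) &
      `|derive1 (derive1 (Phi i)) x - derive1 (derive1 (perturbed i)) x| <=
        (C + C ^+ 2) * (beta * N%:R)].
Proof.
move=> xab.
have h y : y <= C * amplitude i -> y <= (C + C ^+ 2) * (beta * N%:R).
  by move=> /le_trans; apply; rewrite ler_pM// ltW.
split; rewrite distrC.
- exact/h/(perturb_dist m (PhiD i) (@Phi'_neq0 i) ab abD Lam_gt0 (Lam_ge i) (t_gt0 i)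
    (C_bound i) xab).
- exact/h/(derive1_perturb_dist (PhiD i) (@Phi'_neq0 i) ab abD Lam_gt0 (Lam_ge i)
    (t_gt0 i) m_even (C_bound i) xab).
- apply: le_trans (derive2_perturb_dist D_open (PhiD i) (@Phi'_neq0 i) ab abD Lam_gt0
    (Lam_ge i) (t_gt0 i) m_even C_ge0 (C_bound i) xab) _.
  exact: ler_wpM2l.
Qed.

Lemma perturbed_analytic i : real_analytic D (perturbed i).
Proof. exact: perturb_analytic. Qed.

Lemma perturbed_neq0 i x : D x -> derive1 (perturbed i) x != 0.
Proof.
exact: (derive1_perturb_neq0 (PhiD i) (@Phi'_neq0 i) Da Lam_gt0 (t_gt0 i) m_even).
Qed.

Lemma perturbed_immersive i x : a <= x <= b -> immersive_near (perturbed i) x.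
Proof.
move=> /abD; apply: (real_analytic_immersive D_open (perturbed_analytic i)).
by move=> y; exact: perturbed_neq0.
Qed.

Lemma perturbed_itv i x : a <= x <= b -> a + delta <= perturbed i x <= b - delta.
Proof.
move=> xab; have [h _ _] := perturbed_dist i xab; have [m1 m2 _] := margin i xab.
move: (le_trans h betaN_le); rewrite ler_norml => /andP[h1 h2].
by apply/andP; split; lra.
Qed.

Lemma perturbed_contr i x : a <= x <= b -> `|derive1 (perturbed i) x| <= 1 - delta.
Proof.
move=> xab; have [_ h _] := perturbed_dist i xab; have [_ _ m1] := margin i xab.
have {}h := le_trans h betaN_le; rewrite distrC in h.
rewrite -(subrK (derive1 (Phi i) x) (derive1 (perturbed i) x)).
by rewrite (le_trans (ler_normD _ _))// (le_trans (lerD h m1))//; lra.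
Qed.

(** To the right of [a + delta] the phase is at most its value there, which is below 1, and m u^m <=
    1 / (1 - u) for every m. Hence the bound does not involve [m]. *)
Lemma phase_pow_le i x : a + delta <= x <= b ->
  m.+1%:R * phase (Phi i) a Lam x ^+ m <= Q + 1.
Proof.
move=> /andP[ax xb]; have aax : a < a + delta by rewrite ltrDl.
have xab : a <= x <= b by rewrite xb (le_trans (ltW aax)).
have /andP[u0 u1] := phase_itv (PhiD i) (@Phi'_neq0 i) ab abD Lam_gt0 (Lam_ge i) xab.
have uq : phase (Phi i) a Lam x <= phase (Phi i) a Lam (a + delta).
  exact: (phase_le (PhiD i) (@Phi'_neq0 i) ab abD Lam_gt0 (ltW aax) ax xb).
have q1 : phase (Phi i) a Lam (a + delta) < 1.
  apply: (phase_lt1 (PhiD i) (@Phi'_neq0 i) ab abD Lam_gt0).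
  by rewrite aax (le_trans ax xb).
have ult1 := le_lt_trans uq q1.
rewrite -natr1 mulrDl mul1r lerD ?exprn_ile1//.
apply: le_trans (Q_bound i); apply: (@le_trans _ _ (1 - phase (Phi i) a Lam x)^-1).
  rewrite -[leRHS]mul1r ler_pdivlMr ?subr_gt0//.
  by apply: natmul_expr_le1; rewrite u0.
by rewrite lef_pV2 ?posrE ?subr_gt0// lerD2l lerN2.
Qed.

(** The bound of [schwarzian_perturb_le] with [Q + 1] in place of the factor that depends on [m]. It
    is large enough to bound the derivative of T away from [a] and the second derivative of the maps
    as well. *)
Definition uniform_const : R := C + ((Q + 1) * C ^+ 2 + C) + C ^+ 2 + 2 * C ^+ 2.
Local Notation K := uniform_const.

Lemma uniform_const_ge0 : 0 <= K.
Proof. by rewrite !addr_ge0// mulr_ge0 ?addr_ge0// sqr_ge0. Qed.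

Lemma derive1_preschwarzian_perturbed_le i x : a + delta <= x <= b ->
  `|derive1 (preschwarzian (perturbed i)) x| <= K.
Proof.
move=> xb; have xab : a <= x <= b.
  by case/andP: xb => ax ->; rewrite (le_trans _ ax)// lerDl ltW.
apply: le_trans (derive1_preschwarzian_perturb_le D_open (PhiD i) (@Phi'_neq0 i) ab abD
  Lam_gt0 (Lam_ge i) (t_gt0 i) (t_le1 i) m_even C_ge0 (C_bound i) xab) _.
rewrite /K -[leLHS]addr0 lerD ?mulr_ge0 ?sqr_ge0// lerD2r lerD2l lerD2r.
by rewrite ler_wpM2r ?sqr_ge0// phase_pow_le.
Qed.

Lemma schwarzian_perturbed_le i x : a + delta <= x <= b ->
  `|schwarzian (perturbed i) x| <= K.
Proof.
move=> xb; have xab : a <= x <= b.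
  by case/andP: xb => ax ->; rewrite (le_trans _ ax)// lerDl ltW.
apply: le_trans (schwarzian_perturb_le D_open (PhiD i) (@Phi'_neq0 i) ab abD
  Lam_gt0 (Lam_ge i) (t_gt0 i) (t_le1 i) m_even C_ge0 (C_bound i) xab) _.
rewrite /K !lerD2r lerD2l lerD2r.
by rewrite ler_wpM2r ?sqr_ge0// phase_pow_le.
Qed.

(** On the whole segment the bound grows with [m]. This is harmless: it only ensures that the limits
    exist and that the sup norms are finite, and does not enter the separation. *)
Lemma schwarzian_perturbed_leC i x : a <= x <= b ->
  `|schwarzian (perturbed i) x| <=
  C + (m.+1%:R * C ^+ 2 + C) + C ^+ 2 + 2 * C ^+ 2.
Proof.
move=> xab.
have /andP[u0 u1] := phase_itv (PhiD i) (@Phi'_neq0 i) ab abD Lam_gt0 (Lam_ge i) xab.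
apply: le_trans (schwarzian_perturb_le D_open (PhiD i) (@Phi'_neq0 i) ab abD
  Lam_gt0 (Lam_ge i) (t_gt0 i) (t_le1 i) m_even C_ge0 (C_bound i) xab) _.
rewrite !lerD2r lerD2l lerD2r ler_wpM2r ?sqr_ge0//.
by rewrite ler_piMr// exprn_ile1.
Qed.

Lemma derive2_perturbed_le i x : a <= x <= b ->
  `|derive1 (derive1 (perturbed i)) x| <= K.
Proof.
move=> xab; have [_ _ h] := perturbed_dist i xab; have [[_ c _ _] _] := C_bound i xab.
rewrite distrC in h.
rewrite -(subrK (derive1 (derive1 (Phi i)) x) (derive1 (derive1 (perturbed i)) x)).
rewrite (le_trans (ler_normD _ _))// (le_trans (lerD h c))//.
have h2 : (C + C ^+ 2) * (beta * N%:R) <= C + C ^+ 2.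
  by rewrite -[leRHS]mulr1 ler_wpM2l.
apply: (le_trans (lerD h2 (lexx C))); rewrite /K.
have q0 : 0 <= (Q + 1) * C ^+ 2 by rewrite mulr_ge0 ?addr_ge0// sqr_ge0.
have c0 : 0 <= C ^+ 2 by exact: sqr_ge0.
by move: ((Q + 1) * C ^+ 2) (C ^+ 2) q0 c0 => ? ? ? ?; lra.
Qed.

Lemma preschwarzian_perturbed_le i x : a <= x <= b ->
  `|preschwarzian (perturbed i) x| <= 2 * C.
Proof.
exact: (preschwarzian_perturb_le D_open (PhiD i) (@Phi'_neq0 i) ab abD
  Lam_gt0 (Lam_ge i) (t_gt0 i) (t_le1 i) m_even C_ge0 (C_bound i)).
Qed.

Local Notation rho := (1 - delta).
Local Notation M := (2 * C / (1 - rho)).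

(** The coefficient of [x - a] in [preschwarzian_fword_diff] for [B = 2 * C]. It is free of [m], so
    [x] can be chosen before [m]. *)
Definition variation_const : R := (K + M * K) / (1 - rho) + M * K.

(** A letter is an argument because [rho] is seen to be nonnegative through the derivative bound of
    some map. *)
Let rho01 (i : 'I_N) : 0 <= rho < 1.
Proof.
have aab : a <= a <= b by rewrite lexx ltW.
rewrite (le_trans (normr_ge0 _) (perturbed_contr i aab))/=.
by rewrite ltrBlDr ltrDl.
Qed.

Let perturbed_itv' i x : a <= x <= b -> a + delta <= perturbed i x <= b.
Proof.
move=> /(perturbed_itv i)/andP[-> h]; apply: le_trans h _.
by rewrite gerBl ltW.
Qed.

Let aad : a <= a + delta. Proof. by rewrite lerDl ltW. Qed.

(** The condition on [x - a] pays for the tail and for the unperturbed letter. The first condition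
    on [m] pays for the error of the jump at [a], the second for what is left of the perturbation at
    [x], since u^(m+1) <= Q' / (m+1) there. *)
Lemma preschwarzian_word_jump (x Q' : R) i s : a < x <= b ->
  (1 - phase (Phi i) a Lam x)^-1 <= Q' ->
  (C + variation_const) * (x - a) <= beta / Lam / 8 ->
  16 / beta <= m.+1%:R -> 16 * Lam * C * Q' / beta <= m.+1%:R ->
  `|preschwarzian (fword perturbed (i :: s)) a - preschwarzian (fword perturbed (i :: s)) x
    + amplitude i / Lam| <= beta / Lam / 4.
Proof.
move=> axb Q'_bound small m1 m2; have /andP[ax xb] := axb.
have xab : a <= x <= b by rewrite xb ltW.
have aab : a <= a <= b by rewrite lexx ltW.
have C2 : 0 <= 2 * C by rewrite mulr_ge0.
have h1 := preschwarzian_fword_diff aad (rho01 i) perturbed_immersive perturbed_itv'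
  perturbed_contr i s C2 uniform_const_ge0 preschwarzian_perturbed_le
  derive2_perturbed_le derive1_preschwarzian_perturbed_le xab.
have h2 := preschwarzian_perturb_left D_open (PhiD i) (@Phi'_neq0 i) ab abD Lam_gt0
  (t_gt0 i) (t_le1 i) m_even.
have h3 := preschwarzian_perturb_dist D_open (PhiD i) (@Phi'_neq0 i) ab abD
  Lam_gt0 (Lam_ge i) (t_gt0 i) (t_le1 i) m_even C_ge0 (C_bound i) xab.
have h4 : `|preschwarzian (Phi i) a - preschwarzian (Phi i) x| <= C * (x - a).
  have -> : x - a = `|a - x| by rewrite distrC ger0_norm// subr_ge0 ltW.
  apply: (mvt_lipschitz (f' := derive1 (preschwarzian (Phi i))) _ _ aab xab).
    move=> y /abD Dy; apply: is_derive_preschwarzian.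
    exact: (real_analytic_immersive D_open (PhiD i) (@Phi'_neq0 i)).
  by move=> y yab; have [_ []] := C_bound i yab.
have m0 : 0 < m.+1%:R :> R by [].
have h2' : (Lam * m.+2%:R)^-1 <= beta / Lam / 16.
  rewrite invfM mulrAC mulrC ler_pM2r ?invr_gt0//.
  rewrite -[leRHS]invrK lef_pV2 ?posrE ?invr_gt0 ?divr_gt0// invf_div.
  by rewrite (le_trans m1)// ler_nat.
have h3' : C * phase (Phi i) a Lam x ^+ m.+1 <= beta / Lam / 16.
  have /andP[u0 _] := phase_itv (PhiD i) (@Phi'_neq0 i) ab abD Lam_gt0 (Lam_ge i) xab.
  have u1 : phase (Phi i) a Lam x < 1.
    exact: (phase_lt1 (PhiD i) (@Phi'_neq0 i) ab abD Lam_gt0).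
  have uQ : m.+1%:R * phase (Phi i) a Lam x ^+ m.+1 <= Q'.
    apply: le_trans Q'_bound; rewrite -[leRHS]mul1r ler_pdivlMr ?subr_gt0//.
    by apply: natmul_expr_le1; rewrite u0.
  rewrite -(ler_pM2l m0) mulrCA (le_trans (ler_wpM2l C_ge0 uQ))//.
  move: m2; rewrite ler_pdivrMr// => m2.
  by rewrite !mulrA ler_pdivlMr// ler_pdivlMr//; lra.
apply: (norm_combine_jump (le_trans h2 h2') (le_trans h3 h3') h1 h4).
by rewrite -mulrDl.
Qed.

Local Notation T w := (preschwarzian (fword perturbed w)).
Local Notation S w := (schwarzian (fword perturbed w)).

(** The jumps of two letters differ by at least beta / Lam, and the two errors take away at most
    half. The factor 1 is the [kappa] of the infimum criterion. *)
Lemma preschwarzian_word_separation (x Q' : R) i j s s' : i != j -> a < x <= b ->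
  (forall i, (1 - phase (Phi i) a Lam x)^-1 <= Q') ->
  (C + variation_const) * (x - a) <= beta / Lam / 8 ->
  16 / beta <= m.+1%:R -> 16 * Lam * C * Q' / beta <= m.+1%:R ->
  beta / Lam / 2 <= `|(T (i :: s) a - T (j :: s') a) - 1 * (T (i :: s) x - T (j :: s') x)|.
Proof.
move=> ij axb Q'b small m1 m2.
have h1 := preschwarzian_word_jump s axb (Q'b i) small m1 m2.
have h2 := preschwarzian_word_jump s' axb (Q'b j) small m1 m2.
have h3 : beta / Lam <= `|amplitude i / Lam - amplitude j / Lam|.
  rewrite -mulrBl normrM normfV (gtr0_norm Lam_gt0) ler_pM2r ?invr_gt0//.
  exact: amplitude_dist.
rewrite [X in `|X|](_ : _ = (T (i :: s) a - T (i :: s) x) - (T (j :: s') a - T (j :: s') x));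
  last by ring.
apply: (@norm_combine_separation _ _ _ (- (amplitude i / Lam)) (- (amplitude j / Lam))
  (beta / Lam / 4)); rewrite ?opprK//.
rewrite [X in `|X|]addrC distrC; apply: le_trans h3.
by rewrite le_eqVlt; apply/orP; left; apply/eqP; field; rewrite gt_eqF.
Qed.

(** The main terms differ by at least beta (m+1) / Lam^2, while the error of each word is bounded
    independently of [m]; the threshold makes the gap exceed both errors by 1. *)
Lemma schwarzian_word_separation i j s s' : i != j ->
  Lam ^+ 2 * (2 * ((Lam ^+ 2)^-1 + 2 * C + 3 * C ^+ 2 + K / (1 - rho)) + 1) / beta
    <= m.+1%:R ->
  1 <= `|S (i :: s) a - S (j :: s') a|.
Proof.
move=> ij mb; pose q : R := m.+1%:R / Lam ^+ 2.
pose E : R := (Lam ^+ 2)^-1 + 2 * C + 3 * C ^+ 2 + K / (1 - rho).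
have near k w : `|S (k :: w) a - amplitude k * q| <= E.
  have h1 := schwarzian_fword_diff aad (rho01 k) perturbed_immersive perturbed_itv'
    perturbed_contr k w uniform_const_ge0 (ltW ab) schwarzian_perturbed_le.
  have h2 := schwarzian_perturb_left D_open (PhiD k) (@Phi'_neq0 k) ab abD Lam_gt0
    (Lam_ge k) (t_gt0 k) (t_le1 k) m_even C_ge0 (C_bound k).
  rewrite /E /q mulrA.
  rewrite -(subrK (schwarzian (perturbed k) a) (S _ a)) -addrA addrC.
  by rewrite (le_trans (ler_normD _ _))// lerD.
have L2 : 0 < Lam ^+ 2 by rewrite exprn_gt0.
have q0 : 0 < q by rewrite divr_gt0.
have bq : 2 * E + 1 <= beta * q.
  by rewrite /q mulrA ler_pdivlMr// mulrC [leRHS]mulrC -ler_pdivrMr.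
have h3 : beta * q <= `|amplitude i * q - amplitude j * q|.
  by rewrite -mulrBl normrM (gtr0_norm q0) ler_pM2r// amplitude_dist.
apply: (norm_combine_separation (near i s) (near j s')).
exact: le_trans bq h3.
Qed.

End PerturbedIFS.

(** * Choice of the constants, and density *)

Lemma cifs_perturbation (R : realType) (N : nat) (a b : R) (D : set R) (Phi : IFS R N) (e : R) :
  (2 <= N)%N -> a < b -> open D -> closure `]a, b[ `<=` D ->
  cifs `]a, b[ D N Phi -> 0 < e ->
  exists Psi : IFS R N,
    [/\ GS `]a, b[ D N Psi, GT `]a, b[ D N Psi & d2 `]a, b[ Phi Psi < e].
Proof.
move=> N2 ab D_open subD PhiS e0; have e3 : e / 4 + e / 4 + e / 4 < e by lra.
have clE := closure_oo ab.
have abD x : a <= x <= b -> D x by move=> xab; apply: subD; rewrite clE.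
have aab : a <= a <= b by rewrite lexx ltW.
have PhiD i : real_analytic D (Phi i) by have [] := PhiS i.
have Phi'_neq0 i x : D x -> derive1 (Phi i) x != 0 by have [_ h _ _] := PhiS i; exact: h.
have Phi_itv i x : a <= x <= b -> a < Phi i x < b.
  move=> xab; have [_ _ h _] := PhiS i.
  have : `]a, b[%classic (Phi i x) by apply: h; exists x => //; rewrite clE.
  by rewrite /= in_itv.
have Phi_contr i x : a <= x <= b -> `|derive1 (Phi i) x| < 1.
  by move=> xab; have [_ _ _ h] := PhiS i; apply: h; rewrite clE.
have [Lam0 Lam00 Lam0_ge] : exists2 L : R, 0 <= L &
    forall i, (Phi i b - Phi i a) / derive1 (Phi i) a <= L.
  apply: (@finite_upper_bound _ _ (fun i L => (Phi i b - Phi i a) / derive1 (Phi i) a <= L)).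
    by move=> i M M' MM' /le_trans; exact.
  by move=> i; exists `|(Phi i b - Phi i a) / derive1 (Phi i) a| => //; exact: ler_norm.
pose Lam := Lam0 + 1; have Lam_gt0 : 0 < Lam by rewrite ltr_wpDl.
have Lam_ge i : (Phi i b - Phi i a) / derive1 (Phi i) a <= Lam.
  by rewrite (le_trans (Lam0_ge i))// lerDl.
have [C C_ge0 C_bound] := @finite_upper_bound R N (fun i C => forall x, a <= x <= b ->
  [/\ `|derive1 (Phi i) x| <= C, `|derive1 (derive1 (Phi i)) x| <= C,
      `|phase' (Phi i) a Lam x| <= C & `|phase'' (Phi i) a Lam x| <= C] /\
  [/\ `|preschwarzian (Phi i) x| <= C, `|derive1 (preschwarzian (Phi i)) x| <= C &
      `|pscale (Phi i) a Lam| <= C])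
  (fun i M M' MM' h x xab => let: conj (And4 h1 h2 h3 h4) (And3 h5 h6 h7) := h x xab in
    conj (And4 (le_trans h1 MM') (le_trans h2 MM') (le_trans h3 MM') (le_trans h4 MM'))
         (And3 (le_trans h5 MM') (le_trans h6 MM') (le_trans h7 MM')))
  (fun i => profile_bound_exists Lam (PhiD i) (@Phi'_neq0 i) ab abD).
have [delta delta_gt0 margin] : exists2 d : R, 0 < d & forall i x, a <= x <= b ->
    [/\ a + 2 * d <= Phi i x, Phi i x <= b - 2 * d & `|derive1 (Phi i) x| <= 1 - 2 * d].
  apply: (@finite_lower_bound _ _ (fun i d => forall x, a <= x <= b ->
    [/\ a + 2 * d <= Phi i x, Phi i x <= b - 2 * d & `|derive1 (Phi i) x| <= 1 - 2 * d])).
    by move=> i d d' dd' h x xab; have [h1 h2 h3] := h x xab; split; lra.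
  move=> i; apply: (contraction_margin ab _ _ (Phi_itv i) (Phi_contr i)) => x /abD Dx.
    exact: real_analytic_derivable Dx.
  exact: (real_analytic_derivable (real_analytic_derive1 (PhiD i))).
have N0 : 0 < N%:R :> R by rewrite ltr0n (leq_trans _ N2).
pose C1 := C + C ^+ 2.
have C1_ge0 : 0 <= C1 by rewrite addr_ge0// sqr_ge0.
(* [tau] will be [beta * N%:R], a bound for all amplitudes. The entry 1 keeps them at most 1,
   [delta] protects the margin and [e / 4] each of the three sup norms in [d2]; [C1 + 1] avoids
   dividing by 0. *)
pose tau := Num.min 1 (Num.min delta (e / 4) / (C1 + 1)).
have C11 : 0 < C1 + 1 by rewrite ltr_wpDl.
have tau0 : 0 < tau by rewrite lt_min ltr01 divr_gt0// lt_min delta_gt0 divr_gt0.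
have tau1 : tau <= 1 by rewrite ge_min lexx.
have C1tau : C1 * tau <= Num.min delta (e / 4).
  have h : tau <= Num.min delta (e / 4) / (C1 + 1) by rewrite ge_min lexx orbT.
  move: h; rewrite ler_pdivlMr// mulrC; apply: le_trans.
  by rewrite ler_wpM2r ?(ltW tau0)// lerDl.
have [C1d C1e] : C1 * tau <= delta /\ C1 * tau <= e / 4.
  by split; rewrite (le_trans C1tau)// ge_min lexx ?orbT.
pose beta := tau / N%:R; have beta_gt0 : 0 < beta by rewrite divr_gt0.
have betaN : beta * N%:R = tau by rewrite /beta divfK// gt_eqF.
have betaN_le1 : beta * N%:R <= 1 by rewrite betaN.
have betaN_le : (C + C ^+ 2) * (beta * N%:R) <= delta by rewrite betaN.
have i0 : 'I_N := Ordinal N2.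
have adb : a + delta < b by have [h1 h2 _] := margin i0 a aab; lra.
have delta_lt1 : delta < 1.
  by have [_ _ h] := margin i0 a aab; have := normr_ge0 (derive1 (Phi i0) a); lra.
have phase_inv y : a < y <= b ->
    exists2 Q : R, 0 <= Q & forall i, (1 - phase (Phi i) a Lam y)^-1 <= Q.
  move=> yab.
  apply: (@finite_upper_bound _ _ (fun i Q => (1 - phase (Phi i) a Lam y)^-1 <= Q)).
    by move=> i M M' MM' /le_trans; exact.
  move=> i; exists (1 - phase (Phi i) a Lam y)^-1 => //.
  by rewrite invr_ge0 subr_ge0 ltW// (phase_lt1 (PhiD i) (@Phi'_neq0 i) ab abD Lam_gt0).
have [Q Q_ge0 Q_bound] : exists2 Q : R, 0 <= Q &
    forall i, (1 - phase (Phi i) a Lam (a + delta))^-1 <= Q.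
  by apply: phase_inv; rewrite ltrDl delta_gt0 (ltW adb).
pose K := uniform_const C Q; pose V := variation_const C delta Q.
have K_ge0 : 0 <= K by exact: uniform_const_ge0.
have rho0 : 0 < 1 - (1 - delta) by rewrite opprB addrC subrK.
have V_ge0 : 0 <= V.
  have M0 : 0 <= 2 * C / (1 - (1 - delta)) * K.
    by rewrite mulr_ge0// divr_ge0 ?mulr_ge0// ltW.
  apply: (addr_ge0 _ M0); apply: (divr_ge0 _ (ltW rho0)); exact: addr_ge0 K_ge0 M0.
(* [delta] keeps the second evaluation point in the segment; the other entry makes the variation of
   T there at most half of the total error allowed in a jump. *)
pose step := Num.min delta (beta / Lam / 8 / (C + V + 1)).
have CV : 0 < C + V + 1 by rewrite ltr_wpDl// addr_ge0.
have step0 : 0 < step by rewrite lt_min delta_gt0 !divr_gt0.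
pose x := a + step.
have axb : a < x <= b.
  rewrite ltrDl step0 /=; apply: le_trans (ltW adb).
  by rewrite lerD2l ge_min lexx.
have small : (C + V) * (x - a) <= beta / Lam / 8.
  have -> : x - a = step by rewrite /x addrC addKr.
  have h : step <= beta / Lam / 8 / (C + V + 1) by rewrite ge_min lexx orbT.
  move: h; rewrite ler_pdivlMr// mulrC; apply: le_trans.
  by rewrite ler_wpM2r ?(ltW step0)// lerDl.
have [Q' _ Q'_bound] := phase_inv x axb.
pose b1 := 16 / beta; pose b2 := 16 * Lam * C * Q' / beta.
pose b3 := Lam ^+ 2 * (2 * ((Lam ^+ 2)^-1 + 2 * C + 3 * C ^+ 2 + K / (1 - (1 - delta))) + 1)
  / beta.
(* A single exponent beyond the two thresholds for T and the one for S; doubling makes it even. *)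
pose n := Num.bound (`|b1| + `|b2| + `|b3|); pose m := n.*2.
have m_even : ~~ odd m by rewrite odd_double.
have hm : `|b1| + `|b2| + `|b3| <= m.+1%:R.
  have := archi_boundP (addr_ge0 (addr_ge0 (normr_ge0 b1) (normr_ge0 b2)) (normr_ge0 b3)).
  move=> /ltW/le_trans; apply; rewrite ler_nat /m -addnn.
  by rewrite (leq_trans (leq_addr n _)).
have [m1 m2 m3] : [/\ b1 <= m.+1%:R, b2 <= m.+1%:R & b3 <= m.+1%:R].
  have [l1 l2 l3] := And3 (ler_norm b1) (ler_norm b2) (ler_norm b3).
  split; apply: le_trans hm.
  - by rewrite (le_trans l1)// -addrA lerDl addr_ge0.
  - by rewrite (le_trans l2)// addrAC lerDr addr_ge0.
  - by rewrite (le_trans l3)// lerDr addr_ge0.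
pose Psi := perturbed Phi a Lam beta m.
have psi_itv i y : a <= y <= b -> a + delta <= Psi i y <= b - delta.
  exact: (perturbed_itv D_open PhiD Phi'_neq0 ab abD Lam_gt0 Lam_ge C_ge0 C_bound
    margin beta_gt0 betaN_le m_even).
have psi_contr i y : a <= y <= b -> `|derive1 (Psi i) y| <= 1 - delta.
  exact: (perturbed_contr D_open PhiD Phi'_neq0 ab abD Lam_gt0 Lam_ge C_ge0 C_bound
    margin beta_gt0 betaN_le m_even).
have psi_immersive i y : a <= y <= b -> immersive_near (Psi i) y.
  exact: (perturbed_immersive D_open PhiD Phi'_neq0 ab abD Lam_gt0 beta_gt0 m_even).
have psi_itv' i y : a <= y <= b -> a + delta <= Psi i y <= b.
  by move=> /(psi_itv i)/andP[-> h]; rewrite (le_trans h)// gerBl ltW.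
have PsiS : cifs `]a, b[ D N Psi.
  move=> i; split.
  - exact: perturbed_analytic.
  - exact: (perturbed_neq0 PhiD Phi'_neq0 ab abD Lam_gt0 beta_gt0 m_even i).
  - move=> _ [y + <-]; rewrite clE => yab; have /andP[h1 h2] := psi_itv i y yab.
    rewrite /= in_itv/= (lt_le_trans _ h1) ?ltrDl//=.
    by rewrite (le_lt_trans h2)// gtrBl.
  - by move=> y; rewrite clE => yab; rewrite (le_lt_trans (psi_contr i y yab))// gtrBl.
have rho01 : 0 <= 1 - delta < 1 by rewrite subr_ge0 ltW//= gtrBl.
have aad : a <= a + delta by rewrite lerDl ltW.
have xab : a <= x <= b by case/andP: axb => /ltW -> ->.
exists Psi; split.
- split=> //; pose B := C + (m.+1%:R * C ^+ 2 + C) + C ^+ 2 + 2 * C ^+ 2.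
  have B0 : 0 <= B by rewrite !addr_ge0// ?mulr_ge0// ?sqr_ge0.
  apply: (inf_schwarzian_gt0 aad rho01 psi_immersive psi_itv' psi_contr N2 clE B0
    _ aab ltr01).
    exact: (schwarzian_perturbed_leC D_open PhiD Phi'_neq0 ab abD Lam_gt0 Lam_ge C_ge0
      C_bound beta_gt0 betaN_le1 m_even).
  move=> i j s t ij.
  exact: (schwarzian_word_separation D_open PhiD Phi'_neq0 ab abD Lam_gt0 Lam_ge C_ge0
    C_bound delta_gt0 margin beta_gt0 betaN_le1 betaN_le Q_ge0 Q_bound m_even s t ij m3).
- split=> //; have B0 : 0 <= 2 * C by rewrite mulr_ge0.
  have e1 : 0 < beta / Lam / 2 by rewrite !divr_gt0.
  have k1 : `|1 : R| <= 1 by rewrite normr1.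
  apply: (inf_preschwarzian_gt0 aad rho01 psi_immersive psi_itv' psi_contr N2 clE B0
    _ aab xab k1 e1).
    exact: (preschwarzian_perturbed_le D_open PhiD Phi'_neq0 ab abD Lam_gt0 Lam_ge C_ge0
      C_bound beta_gt0 betaN_le1 m_even).
  move=> i j s t ij.
  exact: (preschwarzian_word_separation D_open PhiD Phi'_neq0 ab abD Lam_gt0 Lam_ge C_ge0
    C_bound delta_gt0 margin beta_gt0 betaN_le1 betaN_le Q_ge0 Q_bound m_even s t ij axb
    Q'_bound small m1 m2).
- have close i y := perturbed_dist D_open PhiD Phi'_neq0 ab abD Lam_gt0 Lam_ge C_ge0
    C_bound beta_gt0 m_even i (x := y).
  have sup_le (f : R -> R) : (forall y, a <= y <= b -> `|f y| <= C1 * tau) ->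
      supnorm (closure `]a, b[) f <= e / 4.
    move=> fC; apply: le_trans C1e; apply: supnorm_le; rewrite clE //.
    by exists a.
  rewrite /d2; apply: bigmax_lt => // i _.
  have s1 : supnorm (closure `]a, b[) (Phi i \- Psi i) <= e / 4.
    by apply: sup_le => y yab; have [h _ _] := close i y yab; rewrite -betaN.
  have s2 : supnorm (closure `]a, b[) (derive1 (Phi i) \- derive1 (Psi i)) <= e / 4.
    by apply: sup_le => y yab; have [_ h _] := close i y yab; rewrite -betaN.
  have s3 : supnorm (closure `]a, b[) (derive1n 2 (Phi i) \- derive1n 2 (Psi i)) <= e / 4.
    by apply: sup_le => y yab; have [_ _ h] := close i y yab; rewrite -betaN.
  exact: le_lt_trans (lerD (lerD s1 s2) s3) e3.
Qed.

Theorem theorem9p7 (R : realType) (N : nat) (a b : R) (Omega' : set R)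
    (hN : (2 <= N)%N) (hab : a < b)
    (hopen : open Omega') (hitv : is_interval Omega')
    (hsub : closure `]a, b[ `<=` Omega') :
  d2_dense `]a, b[ (cifs `]a, b[ Omega' N) (GS `]a, b[ Omega' N) /\
  d2_dense `]a, b[ (cifs `]a, b[ Omega' N) (GT `]a, b[ Omega' N).
Proof.
split; split=> [Phi []//|Phi PhiS e e0];
  have [Psi [PsiGS PsiGT]] := cifs_perturbation hN hab hopen hsub PhiS e0;
  by exists Psi.
Qed.
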